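(* Consider the infinite-horizon inventory control problem with the expected total discounted cost criterion described in the context. The functions $v_\alpha(x)$ and $G_\alpha(x)$ are continuous on $\mathbb X$ for all $\alpha\in[0,1)$.
   Context: Inventory model. $(\mathbb X,\mathbb A)$ is either $(\mathbb R,[0,+\infty))$ or $(\mathbb Z,\mathbb N_0)$ with $\mathbb N_0=\{0,1,2,\ldots\}$. Parameters: a fixed ordering cost $K>0$; a unit ordering cost $\bar c>0$; a convex function $h:\mathbb X\to[0,+\infty)$ with $h(0)=0$ and $h(x)\to\infty$ as $|x|\to\infty$ (on $\mathbb Z$, the convexity inequality is required whenever all points involved lie in $\mathbb Z$); i.i.d. nonnegative finite random variables $D_1,D_2,\ldots$ (integer-valued if $\mathbb X=\mathbb Z$), with $D$ denoting a random variable with the same distribution as $D_1$, $\mathbb E[D]<+\infty$, $\mathbb P(D>0)>0$, and $\mathbb E[h(x-D)]<+\infty$ for all $x\in\mathbb X$; a discount factor $\alpha\in[0,1)$. Dynamics: $x_{t+1}=x_t+a_t-D_{t+1}$, $t=0,1,\ldots$, where $x_t\in\mathbb X$ is the inventory level and $a_t\in\mathbb A$ the ordered amount. One-step cost: $c(x,a)=K I_{\{a>0\}}+\bar c a+\mathbb E[h(x+a-D)]$. Policies are (possibly randomized, history-dependent) sequences $\pi=(\pi_0,\pi_1,\ldots)$ of decision rules, $\pi_t$ being a regular transition probability from histories $(x_0,a_0,\ldots,a_{t-1},x_t)$ to $\mathbb A$. Let $v^\pi_\alpha(x)=\mathbb E^\pi_x\left[\sum_{t=0}^{\infty}\alpha^tc(x_t,a_t)\right]$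 and $v_\alpha(x)=\inf_\pi v_\alpha^\pi(x)$. $G_\alpha(x):=\bar c x+\mathbb E[h(x-D)]+\alpha\mathbb E[v_\alpha(x-D)]$, and the optimality equation $v_\alpha(x)=\min_{a\in\mathbb A}\{K I_{\{a>0\}}+G_\alpha(x+a)\}-\bar c x$ holds (known fact). *)

(* Defs.v *)
From HB Require Import structures.
From mathcomp Require Import all_boot all_order all_algebra finmap.
From mathcomp Require Import all_classical all_reals all_analysis.

Set Implicit Arguments.
Unset Strict Implicit.
Unset Printing Implicit Defensive.

Import Order.TTheory GRing.Theory Num.Theory.
Import numFieldNormedType.Exports.

Local Open Scope classical_set_scope.
Local Open Scope ring_scope.

(* The two cases (X, A) = (R, [0, +oo)) and (X, A) = (Z, N_0). The generic
   definitions below are over a carrier T with an embedding iota : T -> R,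
   which induces the topology and the Borel sigma-algebra of X. *)
Variant setting := real_inventory | integer_inventory.

Definition carrier (R : realType) (s : setting) : realDomainType :=
  match s with
  | real_inventory => R
  | integer_inventory => int
  end.

Definition to_real (R : realType) (s : setting) : carrier R s -> R :=
  match s return carrier R s -> R with
  | real_inventory => id
  | integer_inventory => fun z : int => z%:~R
  end.

(* Alias of T used to make it a pointedType, as the library's sigma-algebras
   require; the chosen point is irrelevant. *)
Definition pointed_carrier (T : realDomainType) : Type := T.

HB.instance Definition _ (T : realDomainType) :=
  Choice.copy (pointed_carrier T) T.
HB.instance Definition _ (T : realDomainType) :=
  isPointed.Build (pointed_carrier T) (0 : T).

(* A = {a in X | 0 <= a} *)
Definition nonneg_part (T : realDomainType) : Type := {a : T | 0 <= a}.

HB.instance Definition _ (T : realDomainType) :=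
  Choice.copy (nonneg_part T) {a : T | 0 <= a}.
HB.instance Definition _ (T : realDomainType) :=
  isPointed.Build (nonneg_part T) (exist _ 0 (lexx 0)).

Definition mutually_independent (d d' : measure_display)
    (Omega : measurableType d) (T : measurableType d') (R : realType)
    (P : probability Omega R) (X : nat -> {RV P >-> T}) : Prop :=
  forall (J : {fset nat}) (B : nat -> set T), (forall i, measurable (B i)) ->
    P (\bigcap_(i in [set` J]) (X i @^-1` B i)) =
    (\prod_(i <- J) P (X i @^-1` B i))%E.

Definition identically_distributed (d d' : measure_display)
    (Omega : measurableType d) (T : measurableType d') (R : realType)
    (P : probability Omega R) (X : nat -> {RV P >-> T}) : Prop :=
  forall (i : nat) (B : set T), measurable B ->
    distribution P (X i) B = distribution P (X 0) B.

Section inventory.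
Context (R : realType) (T : realDomainType) (iota : T -> R).

Definition stock :=
  g_sigma_algebra_preimageType (iota : pointed_carrier T -> R).

Definition order_quantity :=
  g_sigma_algebra_preimageType
    ((fun a => iota (sval a)) : nonneg_part T -> R).

Definition amount (a : order_quantity) : T := sval a.

(* On T = int this is convexity along triples of integers. *)
Definition convex_on_carrier (h : T -> R) : Prop :=
  forall (x y z : T) (t : R), 0 <= t <= 1 ->
    iota z = t * iota x + (1 - t) * iota y ->
    h z <= t * h x + (1 - t) * h y.

Definition coercive (h : T -> R) : Prop :=
  forall M : R, exists B : R, forall x : T, B <= `|iota x| -> M <= h x.

(* (x_0, a_0, ..., x_{t-1}, a_{t-1}, x_t) *)
Definition history (t : nat) := (t.-tuple (stock * order_quantity) * stock)%type.

Definition policy := forall t : nat, R.-pker (history t) ~> order_quantity.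

(* Trajectories t |-> (x_t, a_t), with the product sigma-algebra. *)
Definition trajectory :=
  g_sigma_algebraType
    (\bigcup_t preimage_set_system setT
       (fun w : nat -> (stock * order_quantity)%type => w t) measurable).

Definition state_at (t : nat) (w : trajectory) : stock := (w t).1.

Definition action_at (t : nat) (w : trajectory) : order_quantity := (w t).2.

Definition history_at (t : nat) (w : trajectory) : history t :=
  ([tuple w i | i < t], state_at t w).

Context (d : measure_display) (Omega : measurableType d).
Context (P : probability Omega R).
(* D t is the demand D_{t+1}; D 0 serves as the generic demand D. *)
Context (D : nat -> {RV P >-> stock}).
Context (h : T -> R) (K cbar alpha : R).

Definition demand (t : nat) (u : Omega) : T := D t u.

Definition next_state (t : nat) (x : T) (a : order_quantity) (u : Omega) : T :=
  x + amount a - demand t u.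

Definition expected_holding_cost (x : T) : \bar R :=
  'E_P[fun u => h (x - demand 0 u)]%E.

Definition one_step_cost (x : T) (a : order_quantity) : \bar R :=
  ((K * (0 < amount a)%R%:R + cbar * iota (amount a))%:E +
   expected_holding_cost (x + amount a)%R)%E.

(* Q is the law P^pi_x of the controlled process: x_0 = x, the conditional law
   of a_t given the history up to x_t is pi_t, and the conditional law of
   x_{t+1} given the history up to a_t is that of x_t + a_t - D_{t+1}, where
   D_{t+1} is independent of this history. By the Ionescu-Tulcea theorem there
   is exactly one such Q. *)
Definition strategic_measure (pi : policy) (x : T)
    (Q : probability trajectory R) : Prop :=
  [/\ Q [set w | state_at 0 w = x] = 1%E,
      forall (t : nat) (B : set (history t)) (C : set order_quantity),
        measurable B -> measurable C ->
        Q [set w | B (history_at t w) /\ C (action_at t w)] =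
        (\int[Q]_(w in [set w | B (history_at t w)])
           pi t (history_at t w) C)%E
    & forall (t : nat) (B : set (history t * order_quantity)) (C : set stock),
        measurable B -> measurable C ->
        Q [set w | B (history_at t w, action_at t w) /\
                   C (state_at t.+1 w)] =
        (\int[Q]_(w in [set w | B (history_at t w, action_at t w)])
           P [set u | C (next_state t (state_at t w) (action_at t w) u)])%E].

Definition expected_discounted_cost (Q : probability trajectory R) : \bar R :=
  (\int[Q]_w \sum_(0 <= t <oo)
     ((alpha ^+ t)%:E * one_step_cost (state_at t w) (action_at t w)))%E.

(* v_alpha^pi; the infimum ranges over the single measure P^pi_x. *)
Definition policy_value (pi : policy) (x : T) : \bar R :=
  ereal_inf [set expected_discounted_cost Q | Q in strategic_measure pi x].

Definition optimal_value (x : T) : \bar R :=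
  ereal_inf [set policy_value pi x | pi in [set: policy]].

Definition G_alpha (x : T) : \bar R :=
  ((cbar * iota x)%:E + expected_holding_cost x +
   alpha%:E * \int[P]_u optimal_value (x - demand 0 u)%R)%E.

(* f is real-valued, and continuous for the topology induced by the real line
   on X: the usual one if X = R, the discrete one if X = Z. *)
Definition real_valued_continuous (f : T -> \bar R) : Prop :=
  (forall x : T, f x \is a fin_num) /\
  continuous (f : initial_topology iota -> \bar R).

End inventory.

(* Main.v *)
From HB Require Import structures.
Require Import Defs.
From mathcomp Require Import all_boot all_order all_algebra finmap.
From mathcomp Require Import all_classical all_reals all_analysis measurable_realfun.
From mathcomp Require Import ring lra.

Set Implicit Arguments.
Unset Strict Implicit.
Unset Printing Implicit Defensive.

Import Order.TTheory GRing.Theory Num.Theory.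
Import numFieldNormedType.Exports.

Local Open Scope classical_set_scope.
Local Open Scope ring_scope.

(** The optimal value is the limit V of value iteration, and the modulus of
    continuity of the iterates does not depend on the iterate.

    Value iteration starts from an explicit function W ([base_stock_bound]) that
    dominates the cost of ordering up to level zero.  The Bellman operator maps W
    below W ([bellman_base_stock]), so the iterates decrease to V, and V is again a
    fixed point: it is at most the cost to go of any order quantity
    ([value_le_cost_to_go]), and some quantity almost attains it
    ([value_near_optimal]).

    V is the optimal value.  Any law of the controlled process costs at least V
    ([subsolution_le_cost]), because V grows at most like the holding cost, whose
    discounted mean tends to zero whenever the total cost is finite.  Conversely, a
    measurable choice of almost optimal quantities is a stationary policy; its
    process is an explicit function of the independent demands, which provides its
    law ([driven_law_strategic]), and its cost is close to V
    ([cost_le_supersolution]).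

    Continuity comes from imitating one stock by a neighbouring one, and each
    imitation is an inequality that the Bellman operator preserves.  From a higher
    stock one orders less ([bellman_increase]).  From a lower stock one orders more at
    the next order, at the unit cost only ([bellman_decrease]).  The second imitation
    fails when the stock becomes very low before any order, where the slope of the
    holding cost is not controlled; then the difference is ordered at once.  The
    additional fixed cost is weighted by the small discounted probability of this
    event, which [emergency_cost] bounds in the manner of Markov's inequality.  Both
    bounds hold for all iterates, hence for V, and they hold for the cost after an
    order as well.  Since [G_alpha] is that cost plus a linear function, both functions
    are continuous ([one_sided_bounds_controlled], [controlled_continuous]). *)

(** * Stock scales and convex holding costs *)

(** What the proof uses of the two pairs of stock levels and order quantities:
    an additive order embedding into the reals, and a sequence of nonnegative
    elements that is dense from above.  Infima over order quantities then become
    infima of sequences, which keeps measurability elementary.  In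
    [grid_dense] the case [a = 0] is apart because the fixed cost makes the
    order cost jump there: placing no order has to be a grid point itself. *)
Record inventory_scale (R : realType) (T : realDomainType) (iota : T -> R)
    (grid : nat -> T) : Prop := InventoryScale {
  scaleD : forall x y, iota (x + y) = iota x + iota y;
  scale_le : forall x y, (iota x <= iota y) = (x <= y);
  scale1 : iota 1 = 1;
  grid_ge0 : forall k, 0 <= grid k;
  grid_dense : forall a eta, 0 <= a -> 0 < eta -> exists k,
    [/\ a <= grid k, iota (grid k) <= iota a + eta & a = 0 -> grid k = 0] }.

Section scale.
Context (R : realType) (T : realDomainType) (iota : T -> R) (grid : nat -> T).
Hypothesis is_scale : inventory_scale iota grid.

Lemma scale0 : iota 0 = 0.
Proof. by have := scaleD is_scale 0 0; rewrite addr0; lra. Qed.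

Lemma scaleN x : iota (- x) = - iota x.
Proof. by have := scaleD is_scale x (- x); rewrite subrr scale0; lra. Qed.

Lemma scaleB x y : iota (x - y) = iota x - iota y.
Proof. by rewrite (scaleD is_scale) scaleN. Qed.

Lemma scale_nat n : iota n%:R = n%:R.
Proof.
by elim: n => [|n IH]; rewrite ?scale0// -natr1 (scaleD is_scale) IH
  (scale1 is_scale) natr1.
Qed.

Lemma scale_lt x y : (iota x < iota y) = (x < y).
Proof. by rewrite !ltNge (scale_le is_scale). Qed.

Lemma scale_ge0 x : (0 <= iota x) = (0 <= x).
Proof. by rewrite -scale0 (scale_le is_scale). Qed.

Lemma scale_gt0 x : (0 < iota x) = (0 < x).
Proof. by rewrite -scale0 scale_lt. Qed.

Lemma scale_max x y : iota (Num.max x y) = Num.max (iota x) (iota y).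
Proof. by rewrite !maxEle (scale_le is_scale); case: ifP. Qed.

Lemma scale_inj : injective iota.
Proof.
by move=> x y e; apply/eqP; rewrite eq_le -!(scale_le is_scale) e lexx.
Qed.

Lemma measurable_to_stock d (X : measurableType d) (f : X -> T) :
  measurable_fun setT (fun x => iota (f x)) ->
  measurable_fun setT (f : X -> stock iota).
Proof.
move=> mf _ _ [B mB <-]; rewrite !setTI.
by have := mf measurableT _ mB; rewrite setTI.
Qed.

Lemma measurable_to_order d (X : measurableType d) (f : X -> nonneg_part T) :
  measurable_fun setT (fun x => iota (sval (f x))) ->
  measurable_fun setT (f : X -> order_quantity iota).
Proof.
move=> mf _ _ [B mB <-]; rewrite !setTI.
by have := mf measurableT _ mB; rewrite setTI.
Qed.

Lemma measurable_scale : measurable_fun setT (iota : stock iota -> R).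
Proof. by move=> _ B mB; rewrite setTI; exists B => //; rewrite setTI. Qed.

Lemma measurable_scale_comp d (X : measurableType d) (f : X -> stock iota) :
  measurable_fun setT f -> measurable_fun setT (fun x => iota (f x)).
Proof. by move=> mf; apply: measurableT_comp measurable_scale mf. Qed.

Lemma measurable_amount :
  measurable_fun setT (@amount R T iota : order_quantity iota -> stock iota).
Proof.
apply: measurable_to_stock => _ B mB; rewrite setTI.
by exists B => //; rewrite setTI.
Qed.

Lemma measurable_stockD d (X : measurableType d) (f g : X -> stock iota) :
  measurable_fun setT f -> measurable_fun setT g ->
  measurable_fun setT ((fun x => (f x : T) + (g x : T)) : X -> stock iota).
Proof.
move=> mf mg; apply: measurable_to_stock.
under eq_fun do rewrite (scaleD is_scale).
by apply: measurable_funD; exact: measurable_scale_comp.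
Qed.

Lemma measurable_stockB d (X : measurableType d) (f g : X -> stock iota) :
  measurable_fun setT f -> measurable_fun setT g ->
  measurable_fun setT ((fun x => (f x : T) - (g x : T)) : X -> stock iota).
Proof.
move=> mf mg; apply: measurable_to_stock.
under eq_fun do rewrite scaleB.
by apply: measurable_funB; exact: measurable_scale_comp.
Qed.

Lemma measurable_stock_max0 :
  measurable_fun setT ((fun x => Num.max x 0 : T) : stock iota -> stock iota).
Proof.
apply: measurable_to_stock.
under eq_fun do rewrite scale_max.
by apply: measurable_maxr => //; exact: measurable_scale.
Qed.

Lemma measurable_stock1 (x : T) : measurable ([set x] : set (stock iota)).
Proof.
exists [set iota x]; first exact: measurable_set1.
by rewrite setTI; apply/seteqP; split=> [y /= /scale_inj|y /= ->].
Qed.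

(** The Borel structure on stocks is pulled back along [iota], and an order-convex
    set is the preimage of the smallest interval that contains its image. *)
Lemma stock_convex_set_measurable (A : set T) :
  (forall x y z, A x -> A y -> x <= z <= y -> A z) ->
  measurable (A : set (stock iota)).
Proof.
move=> convA.
pose I := [set r : R | exists x y, [/\ A x, A y & iota x <= r <= iota y]].
exists I; last first.
  rewrite setTI; apply/seteqP; split=> [z [x [y [Ax Ay]]]|z Az].
    by rewrite !(scale_le is_scale); exact: convA.
  by exists z, z; split => //; rewrite lexx.
apply: is_interval_measurable => r s [x [_ [Ax _ /andP[xr _]]]].
move=> [_ [y [_ Ay /andP[_ sy]]]] z /andP[rz zs].
by exists x, y; split => //; lra.
Qed.


Section holding_cost.
Context (h : T -> R).
Hypotheses (h_ge0 : forall x, 0 <= h x) (h0 : h 0 = 0).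
Hypothesis h_convex : convex_on_carrier iota h.

(** The convexity inequality with denominators cleared, which is the form that
    makes sense on the integers as well. *)
Lemma convex_chord x y z : x <= z <= y -> x < y ->
  (iota y - iota x) * h z <=
  (iota y - iota z) * h x + (iota z - iota x) * h y.
Proof.
move=> /andP[xz zy]; rewrite -scale_lt => xy.
have d0 : 0 < iota y - iota x by lra.
move: xz zy; rewrite -!(scale_le is_scale) => xz zy.
set t := (iota y - iota z) / (iota y - iota x).
have tE : t * (iota y - iota x) = iota y - iota z by rewrite divfK// gt_eqF.
have t01 : 0 <= t <= 1 by rewrite divr_ge0 ?ler_pdivrMr ?mul1r; lra.
have zE : iota z = t * iota x + (1 - t) * iota y by move: tE; nra.
have := h_convex t01 zE.
rewrite -(ler_pM2l d0) => /le_trans; apply.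
rewrite le_eqVlt; apply/orP; left; apply/eqP.
rewrite -tE.
have -> : iota z - iota x = (1 - t) * (iota y - iota x) by rewrite zE; ring.
by ring.
Qed.

(** A nonnegative convex function is bounded inside an interval by its values at the
    two ends; the sum is a crude but sufficient bound. *)
Lemma holding_le_ends x y z : x <= z <= y -> h z <= h x + h y.
Proof.
move=> xzy; have [xy|yx] := ltP x y; last first.
  have -> : z = x by apply/eqP; rewrite eq_le; lra.
  by rewrite lerDl.
have := convex_chord xzy xy.
move: xzy xy; rewrite -!(scale_le is_scale) -scale_lt => /andP[xz zy] xy H.
have d0 : 0 < iota y - iota x by lra.
rewrite -(ler_pM2l d0); apply: (le_trans H).
by rewrite mulrDr lerD// ler_wpM2r//; lra.
Qed.

Lemma holding_nondecreasing x y : 0 <= x -> x <= y -> h x <= h y.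
Proof.
move=> x0 xy; have [->|y0] := eqVneq x 0; first by rewrite h0.
have yp : 0 < y by rewrite (lt_le_trans _ xy)// lt_def y0.
have /convex_chord/(_ yp) : 0 <= x <= y by rewrite x0.
rewrite h0 scale0 mulr0 add0r !subr0 => H.
have ip : 0 < iota y by rewrite scale_gt0.
rewrite -(ler_pM2l ip); apply: (le_trans H).
by rewrite ler_wpM2r// (scale_le is_scale).
Qed.

Lemma holding_nonincreasing x y : x <= y -> y <= 0 -> h y <= h x.
Proof.
move=> xy y0; have [->|yn0] := eqVneq y 0; first by rewrite h0.
have xn : x < 0 by rewrite (le_lt_trans xy)// lt_def eq_sym yn0.
have /convex_chord/(_ xn) : x <= y <= 0 by rewrite xy.
rewrite h0 scale0 mulr0 addr0 !sub0r => H.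
have ip : 0 < - iota x by rewrite -scaleN scale_gt0; lra.
rewrite -(ler_pM2l ip); apply: (le_trans H).
by rewrite ler_wpM2r// -!scaleN (scale_le is_scale); lra.
Qed.

(** To the right of zero the slope of [h] on a unit step is at most the next value of
    [h]; to the left of zero [h] only decreases.  The bound involves nothing but
    the right end, which is what survives the subtraction of a demand. *)
Lemma holding_incr x y : x <= y -> y - x <= 1 ->
  h y - h x <= (iota y - iota x) * h (Num.max y 0 + 1).
Proof.
move=> xy yx1.
have ixy : iota x <= iota y by rewrite (scale_le is_scale).
have [y0|y0] := leP y 0.
  have := holding_nonincreasing xy y0.
  have : 0 <= (iota y - iota x) * h (Num.max y 0 + 1) by rewrite mulr_ge0//; lra.
  by rewrite max_r//; lra.
have [x0|x0] := leP 0 x; last first.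
  have /convex_chord : 0 <= y <= y + 1 by lra.
  rewrite h0 scale0 (scaleD is_scale) (scale1 is_scale) => /(_ ltac:(lra)).
  have iy : 0 < iota y by rewrite scale_gt0.
  have ix : iota x < 0 by rewrite -scale0 scale_lt.
  have := h_ge0 x; have := h_ge0 (y + 1); have := h_ge0 y.
  by nra.
have /convex_chord : x <= y <= x + 1 by lra.
rewrite (scaleD is_scale) (scale1 is_scale) => /(_ ltac:(lra)).
have hxy : h (x + 1) <= h (y + 1) by apply: holding_nondecreasing; lra.
have := h_ge0 x; have := h_ge0 (y + 1); have := h_ge0 y.
by nra.
Qed.

(** By convexity the slope is at most the decrease over one unit further left, and [h] is
    nonnegative.  In contrast with [holding_incr] the bound deteriorates when a demand
    is subtracted. *)
Lemma holding_decr x y : x <= y -> y - x <= 1 ->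
  h x - h y <= (iota y - iota x) * h (y - 1).
Proof.
move=> xy yx1.
have ixy : iota x <= iota y by rewrite (scale_le is_scale).
have /convex_chord : y - 1 <= x <= y by lra.
rewrite scaleB (scale1 is_scale) => /(_ ltac:(lra)).
have := h_ge0 y; have := h_ge0 (y - 1); have := h_ge0 x.
by nra.
Qed.

(** Coercivity gives one point where [h] is at least 1, and convexity makes [h] lie above
    the line through that point and the origin further left. *)
Lemma holding_grows_linearly : coercive iota h ->
  exists2 m : R, 0 < m & forall x, - iota x <= m * (1 + h x).
Proof.
move=> /(_ 1)[B hB].
pose n := (Num.truncn `|B|).+1.
have nB : B <= n%:R.
  by rewrite (le_trans (ler_norm _))// ltW// truncnS_gt.
have n0 : (0 : R) < n%:R by rewrite ltr0n.
exists n%:R => // x.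
have hn : 1 <= h (- n%:R) by apply: hB; rewrite scaleN scale_nat normrN ger0_norm.
have [xn|xn] := leP (- iota x) n%:R.
  by have := h_ge0 x; nra.
have /convex_chord : x <= (- n%:R : T) <= 0.
  by rewrite -!(scale_le is_scale) scaleN scale_nat scale0; lra.
rewrite -scale_lt scale0 h0 scaleN scale_nat => /(_ ltac:(lra)).
have := h_ge0 x.
by nra.
Qed.

(** The sublevel sets are order-convex since [h] decreases up to zero and increases
    afterwards. *)
Lemma measurable_holding : measurable_fun setT (h : stock iota -> R).
Proof.
apply: (measurability _ (RGenOInfty.measurableE R)) => //.
move=> _ [_ [r ->] <-]; rewrite setTI -[X in measurable X]setCK.
apply: measurableC; apply: stock_convex_set_measurable => x y z.
rewrite /= !in_itv/= !andbT => /negP; rewrite -leNgt => hx.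
move=> /negP; rewrite -leNgt => hy xzy; apply/negP; rewrite -leNgt.
move: xzy => /andP[xz zy].
have [z0|z0] := leP 0 z.
  exact: le_trans (holding_nondecreasing z0 zy) hy.
exact: le_trans (holding_nonincreasing xz (ltW z0)) hx.
Qed.

End holding_cost.
End scale.

(** * Averages over one demand *)

Section after_demand.
Context (R : realType) (T : realDomainType) (iota : T -> R) (grid : nat -> T).
Hypothesis is_scale : inventory_scale iota grid.
Context (d : measure_display) (Omega : measurableType d).
Context (P : probability Omega R) (X : {RV P >-> stock iota}).
Hypothesis X_ge0 : forall u, 0 <= (X u : T).

Definition after_demand (f : T -> R) (x : T) : R := \int[P]_u f (x - X u).

Definition demand_integrable (f : T -> R) : Prop :=
  measurable_fun setT (f : stock iota -> R) /\
  forall x, P.-integrable setT (fun u => (f (x - X u))%:E).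

Lemma measurable_after x : measurable_fun setT ((fun u => x - X u) : Omega -> stock iota).
Proof.
by apply: (measurable_stockB is_scale); [exact: measurable_cst|exact: measurable_funP].
Qed.

Lemma measurable_after_comp (f : T -> R) x :
  measurable_fun setT (f : stock iota -> R) ->
  measurable_fun setT (fun u => f (x - X u)).
Proof. by move=> mf; apply: measurableT_comp mf (measurable_after x). Qed.

Lemma after_demand_fin f x : demand_integrable f ->
  (\int[P]_u (f (x - X u))%:E)%E = (after_demand f x)%:E.
Proof. by move=> [_ fi]; rewrite /after_demand/Rintegral fineK// integrable_fin_num. Qed.

Lemma demand_integrable_cst r : demand_integrable (cst r).
Proof.
split; first exact: measurable_cst.
by move=> x; exact: finite_measure_integrable_cst.
Qed.

Lemma demand_integrableD f g : demand_integrable f -> demand_integrable g ->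
  demand_integrable (fun x => f x + g x).
Proof.
move=> [mf fi] [mg gi]; split; first exact: measurable_funD.
by move=> x; have := integrableD measurableT (fi x) (gi x).
Qed.

Lemma demand_integrableZ r f : demand_integrable f ->
  demand_integrable (fun x => r * f x).
Proof.
move=> [mf fi]; split; first exact: measurable_funM.
by move=> x; have := integrableZl measurableT r (fi x).
Qed.

Lemma demand_integrable_shift f : demand_integrable f ->
  forall y, demand_integrable (fun x => f (x + y)).
Proof.
move=> [mf fi] y; split.
  apply: measurableT_comp mf _.
  by apply: (measurable_stockD is_scale).
by move=> x; under eq_fun do rewrite addrAC; exact: fi.
Qed.

(** Three different starting stocks are allowed since a comparison of costs typically
    involves two neighbouring stocks and an error term evaluated at a third one. *)
Lemma after_demand_le f g k a r x y z :
  demand_integrable f -> demand_integrable g -> demand_integrable k ->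
  (forall t : T, 0 <= t -> f (x - t) <= a + g (y - t) + r * k (z - t)) ->
  after_demand f x <= a + after_demand g y + r * after_demand k z.
Proof.
move=> [_ /(_ x) fi] [_ /(_ y) gi] [_ /(_ z) ki] le.
have ci : P.-integrable setT (EFin \o cst a) by exact: finite_measure_integrable_cst.
have ri : P.-integrable setT (EFin \o (fun u => r * k (z - X u))).
  by have := integrableZl measurableT r ki.
have agi : P.-integrable setT (EFin \o (fun u => a + g (y - X u))).
  by have := integrableD measurableT ci gi.
rewrite /after_demand -[X in X + _ + _](_ : \int[P]_u cst a u = a); last first.
  by rewrite Rintegral_cst//= probability_setT mulr1.
rewrite -RintegralD// -RintegralZl// -RintegralD//.
apply: le_Rintegral => //; first by have := integrableD measurableT agi ri.
by move=> u _; exact: le.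
Qed.

Lemma after_demand_mono f g a x y :
  demand_integrable f -> demand_integrable g ->
  (forall t : T, 0 <= t -> f (x - t) <= a + g (y - t)) ->
  after_demand f x <= a + after_demand g y.
Proof.
move=> fi gi le; have := @after_demand_le f g (cst 0) a 0 x y 0 fi gi
  (demand_integrable_cst 0).
by rewrite mul0r addr0; apply=> t /le; rewrite mul0r addr0.
Qed.

Lemma after_demand_ge0 f x : (forall y, 0 <= f y) -> 0 <= after_demand f x.
Proof. by move=> f0; exact: Rintegral_ge0. Qed.

Lemma after_demand_cst r x : after_demand (cst r) x = r.
Proof. by rewrite /after_demand Rintegral_cst//= probability_setT mulr1. Qed.

Lemma demand_integrable_le f g : measurable_fun setT (f : stock iota -> R) ->
  (forall x, 0 <= f x <= g x) -> demand_integrable g -> demand_integrable f.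
Proof.
move=> mf fg [mg gi]; split => // x; apply: le_integrable (gi x) => //.
  by apply/measurable_EFinP; exact: measurable_after_comp.
move=> u _ /=; rewrite lee_fin.
by have /andP[f0 fleg] := fg (x - X u); rewrite !ger0_norm// (le_trans f0).
Qed.

(** Measurability in the stock is Tonelli's theorem for the product of the stock space
    and the probability space. *)
Lemma measurable_after_demand f :
  measurable_fun setT (f : stock iota -> R) -> (forall x, 0 <= f x) ->
  measurable_fun setT (after_demand f : stock iota -> R).
Proof.
move=> mf f0.
have mF : measurable_fun setT (fun xu : stock iota * Omega =>
    (f ((xu.1 : T) - (X xu.2 : T)))%:E).
  apply/measurable_EFinP; apply: (measurableT_comp mf).
  apply: (measurable_stockB is_scale) => //.
  by apply: measurableT_comp => //; exact: measurable_funP.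
rewrite (_ : after_demand f = fine \o fubini_F P (fun xu : stock iota * Omega =>
    (f ((xu.1 : T) - (X xu.2 : T)))%:E))//.
apply: measurableT_comp; first exact: fine_measurable.
by apply: measurable_fun_fubini_tonelli_F => // xu; rewrite lee_fin.
Qed.

Lemma after_demand_cvg (f_ : nat -> T -> R) f g x :
  (forall n, measurable_fun setT (f_ n : stock iota -> R)) ->
  (forall n y, 0 <= f_ n y <= g y) ->
  measurable_fun setT (f : stock iota -> R) -> demand_integrable g ->
  (forall y, f_ n y @[n --> \oo] --> f y) ->
  after_demand (f_ n) x @[n --> \oo] --> after_demand f x.
Proof.
move=> mf_ f_g mf [mg gi] cvf.
have [|||||] := @dominated_convergence _ _ _ P setT measurableT
  (fun n u => (f_ n (x - X u))%:E) (fun u => (f (x - X u))%:E)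
  (fun u => (g (x - X u))%:E) => //.
- by move=> n; apply/measurable_EFinP; exact: measurable_after_comp.
- by apply/measurable_EFinP; exact: measurable_after_comp.
- by apply: aeW => u _; apply/fine_cvgP; split; [exact: nearW|exact: cvf].
- apply: aeW => u n _ /=; rewrite lee_fin.
  by have /andP[f0 fg] := f_g n (x - X u); rewrite ger0_norm.
move=> fi _ cv.
by apply: fine_cvg; rewrite fineK//; exact: integrable_fin_num.
Qed.

End after_demand.

(** * Infima of sequences *)

Section infimum.
Context (R : realType).
Implicit Type u : nat -> R.

Lemma inf_seq_le u a : (forall n, a <= u n) -> forall n, inf (range u) <= u n.
Proof. by move=> au n; apply: ge_inf; [exists a => _ [m _ <-]|exists n]. Qed.

Lemma le_inf_seq u a : (forall n, a <= u n) -> a <= inf (range u).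
Proof. by move=> au; apply: lb_le_inf => [|_ [n _ <-]//]; exists (u 0), 0. Qed.

Lemma inf_seq_near u a : (forall n, a <= u n) ->
  forall eps, 0 < eps -> exists n, u n < inf (range u) + eps.
Proof.
move=> au eps e0.
have hi : has_inf (range u) by split; [exists (u 0), 0|exists a => _ [m _ <-]].
by have [_ [n _ <-] lt] := inf_adherent e0 hi; exists n.
Qed.

Lemma measurable_inf_seq d (X : measurableType d) (f : nat -> X -> R) a :
  (forall n x, a <= f n x) -> (forall n, measurable_fun setT (f n)) ->
  measurable_fun setT (fun x => inf (range (f ^~ x))).
Proof.
move=> af mf; rewrite (_ : (fun x => _) = fun x => infs (f ^~ x) 0).
  by apply: measurable_fun_infs => // x _; exists a => _ [n _ <-].
apply/funext => x; rewrite /infs; congr inf.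
by apply/seteqP; split=> _ [n _ <-]; exists n.
Qed.

End infimum.

(** * Value iteration *)

Section dynamic_programming.
Context (R : realType) (T : realDomainType) (iota : T -> R) (grid : nat -> T).
Hypothesis is_scale : inventory_scale iota grid.
Context (d : measure_display) (Omega : measurableType d).
Context (P : probability Omega R) (X : {RV P >-> stock iota}).
Hypothesis X_ge0 : forall u, 0 <= (X u : T).
Context (h : T -> R) (K cbar alpha : R).
Hypotheses (K_gt0 : 0 < K) (cbar_gt0 : 0 < cbar).
Hypotheses (alpha_ge0 : 0 <= alpha) (alpha_lt1 : alpha < 1).
Hypotheses (h_ge0 : forall x, 0 <= h x) (h0 : h 0 = 0).
Hypothesis h_convex : convex_on_carrier iota h.

Definition shortage (x : T) : R := Num.max (- iota x) 0.

Hypothesis h_int : demand_integrable X h.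
Hypothesis shortage_int : demand_integrable X shortage.

Definition order_cost (a : T) : R := K * (0 < a)%R%:R + cbar * iota a.

(** The function [G_alpha] up to its linear part, with [f] in the place of the value
    function. *)
Definition post_order_cost (f : T -> R) (y : T) : R :=
  after_demand X h y + alpha * after_demand X f y.

Definition cost_to_go (f : T -> R) (x a : T) : R :=
  order_cost a + post_order_cost f (x + a).

Definition bellman (f : T -> R) (x : T) : R :=
  inf (range (fun k => cost_to_go f x (grid k))).

Let C : R := (1 - alpha)^-1.
Let mu : R := after_demand X shortage 0.

(** An explicit supersolution of the optimality equation.  It dominates the cost of the
    policy that orders up to level zero whenever the stock is negative: the
    constant pays for one fixed cost, the holding cost from level zero and the
    replenishment of one demand per period; [shortage] pays for the first order;
    the last term pays for the initial surplus, as long as it lasts. *)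
Definition base_stock_bound (x : T) : R :=
  C * (K + after_demand X h 0 + alpha * (cbar * mu)) +
  cbar * shortage x + C * h (Num.max x 0).

Let W := base_stock_bound.

Let C_ge1 : 1 <= C.
Proof. by rewrite /C invf_ge1 ?subr_gt0 ?alpha_lt1// lerBlDr lerDl alpha_ge0. Qed.

Let CE : C * (1 - alpha) = 1.
Proof. by rewrite /C mulVf// gt_eqF//; have := alpha_lt1; lra. Qed.

Let C_split v : C * v = v + alpha * (C * v).
Proof. by rewrite -[X in _ = X + _]mul1r -CE; ring. Qed.

Ltac lra_params := have := alpha_ge0; have := alpha_lt1; have := K_gt0;
  have := cbar_gt0; have := C_ge1; lra.
Ltac nra_params := have := alpha_ge0; have := alpha_lt1; have := K_gt0;
  have := cbar_gt0; have := C_ge1; nra.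

Lemma shortage_ge0 x : 0 <= shortage x.
Proof. by rewrite /shortage le_max lexx orbT. Qed.

Lemma shortage_after t x : 0 <= t -> shortage (x - t) <= shortage x + iota t.
Proof.
rewrite -(scale_ge0 is_scale) /shortage (scaleB is_scale) => t0.
by rewrite /Num.max; do 2 case: ifPn; rewrite -?leNgt; lra.
Qed.

Lemma shortage_sub x y : x <= y -> shortage x - shortage y <= iota y - iota x.
Proof.
rewrite -(scale_le is_scale) /shortage => xy.
by rewrite /Num.max; do 2 case: ifPn; rewrite -?leNgt; lra.
Qed.

Lemma shortage_opp t : 0 <= t -> shortage (0 - t) = iota t.
Proof.
by rewrite -(scale_ge0 is_scale) /shortage sub0r (scaleN is_scale) opprK => t0; rewrite max_l.
Qed.

Let mu_ge0 : 0 <= mu.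
Proof. by apply: after_demand_ge0; exact: shortage_ge0. Qed.

Lemma after_demand_shortage x : after_demand X shortage x <= shortage x + mu.
Proof.
rewrite /mu; apply: (after_demand_mono X_ge0) => // t t0.
by rewrite shortage_opp// shortage_after.
Qed.

Lemma measurable_shortage : measurable_fun setT (shortage : stock iota -> R).
Proof.
apply: measurable_maxr => //; apply: measurable_funN.
exact: measurable_scale.
Qed.

Let hmono := holding_nondecreasing is_scale h_ge0 h0 h_convex.

Lemma order_cost_ge0 a : 0 <= a -> 0 <= order_cost a.
Proof.
rewrite -(scale_ge0 is_scale) /order_cost => a0.
by apply: addr_ge0; apply: mulr_ge0 => //; exact: ltW.
Qed.

Lemma order_cost0 : order_cost 0 = 0.
Proof. by rewrite /order_cost ltxx (scale0 is_scale) !mulr0 addr0. Qed.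

Lemma order_cost_gt0 a : 0 < a -> order_cost a = K + cbar * iota a.
Proof. by rewrite /order_cost => ->; rewrite mulr1. Qed.

Lemma order_cost_le a : order_cost a <= K + cbar * iota a.
Proof.
by rewrite /order_cost lerD2r ler_piMr//; [exact: ltW|case: (0 < a)].
Qed.

Lemma order_cost_mono a b : 0 <= a -> a <= b -> order_cost a <= order_cost b.
Proof.
rewrite le_eqVlt => /predU1P[<-|a0] ab; first by rewrite order_cost0 order_cost_ge0.
rewrite !order_cost_gt0//; last exact: lt_le_trans ab.
by rewrite lerD2l ler_pM2l// (scale_le is_scale).
Qed.

Definition below_base_stock (f : T -> R) : Prop :=
  measurable_fun setT (f : stock iota -> R) /\ forall x, 0 <= f x <= W x.

Lemma base_stock_bound_ge0 x : 0 <= W x.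
Proof.
rewrite /W /base_stock_bound.
have H0 := after_demand_ge0 X 0 h_ge0.
have C0 : 0 <= C by lra_params.
have am : 0 <= alpha * (cbar * mu) by rewrite !mulr_ge0// ltW.
apply: addr_ge0; last exact: mulr_ge0.
apply: addr_ge0; last by rewrite mulr_ge0 ?shortage_ge0 ?ltW.
by rewrite mulr_ge0//; lra_params.
Qed.

Lemma base_stock_bound_measurable : measurable_fun setT (W : stock iota -> R).
Proof.
apply: measurable_funD; first apply: measurable_funD => //.
  by apply: measurable_funM => //; exact: measurable_shortage.
apply: measurable_funM => //.
apply: (measurableT_comp (measurable_holding is_scale h_ge0 h0 h_convex)).
exact: (measurable_stock_max0 is_scale).
Qed.

(** Only the negative part of the stock can grow when a demand is subtracted, and it
    grows by at most the demand, whose mean is finite.  This is where [h] on the left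
    of zero has to be absent from the bound: two consecutive unmet demands may have
    an infinite expected holding cost. *)
Lemma base_stock_bound_integrable : demand_integrable X W.
Proof.
split; first exact: base_stock_bound_measurable.
move=> x; pose g y := (W x + cbar * shortage y).
have gi : demand_integrable X g.
  exact: (demand_integrableD (demand_integrable_cst _ _) (demand_integrableZ _ _)).
have [_ /(_ x)] := gi; apply: le_integrable => //.
  apply/measurable_EFinP; apply: (measurable_after_comp is_scale).
  exact: base_stock_bound_measurable.
move=> u _ /=; rewrite lee_fin /g ger0_norm ?base_stock_bound_ge0//.
apply: le_trans (ler_norm _).
have hle : h (Num.max ((x : T) - (X u : T)) 0) <= h (Num.max x 0).
  apply: hmono; first by rewrite le_max lexx orbT.
  by rewrite ge_max !le_max lexx orbT andbT lerBlDr lerDl X_ge0.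
have := shortage_ge0 x.
by rewrite /W /base_stock_bound; move: hle; nra_params.
Qed.

Lemma below_base_stock_integrable f :
  below_base_stock f -> demand_integrable X f.
Proof.
move=> [mf fW]; apply: (demand_integrable_le is_scale mf fW).
exact: base_stock_bound_integrable.
Qed.

Lemma post_order_cost_ge0 f y : (forall x, 0 <= f x) -> 0 <= post_order_cost f y.
Proof.
move=> f0; apply: addr_ge0; first exact: after_demand_ge0.
by apply: mulr_ge0; [exact: alpha_ge0|exact: after_demand_ge0].
Qed.

Lemma cost_to_go_ge0 f x a : (forall x, 0 <= f x) -> 0 <= a ->
  0 <= cost_to_go f x a.
Proof. by move=> f0 a0; rewrite addr_ge0 ?order_cost_ge0 ?post_order_cost_ge0. Qed.

Lemma cost_to_go_mono f g x a : demand_integrable X f -> demand_integrable X g ->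
  (forall y, f y <= g y) -> cost_to_go f x a <= cost_to_go g x a.
Proof.
move=> fi gi fg; rewrite /cost_to_go/post_order_cost !lerD2l ler_wpM2l//.
rewrite -[leRHS]add0r; apply: (after_demand_mono X_ge0) => // t _.
by rewrite add0r.
Qed.

Lemma measurable_cost_to_go f a : below_base_stock f ->
  measurable_fun setT (cost_to_go f ^~ a : stock iota -> R).
Proof.
move=> [mf fW].
have madd : measurable_fun setT ((fun x => (x : T) + a) : stock iota -> stock iota).
  by apply: (measurable_stockD is_scale) => //; exact: measurable_cst.
apply: measurable_funD => //; apply: measurable_funD.
  apply: measurableT_comp madd; apply: (measurable_after_demand is_scale) => //.
  by have [] := h_int.
apply: measurable_funM => //.
apply: measurableT_comp madd; apply: (measurable_after_demand is_scale) => //.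
by move=> x; have /andP[] := fW x.
Qed.

Lemma cost_to_go_grid_ge0 f x k : below_base_stock f ->
  0 <= cost_to_go f x (grid k).
Proof.
move=> [_ fW]; apply: cost_to_go_ge0; last exact: grid_ge0 is_scale k.
by move=> y; have /andP[] := fW y.
Qed.

(** A bound for the slope of [h], to the right, summed over all periods with
    discount. *)
Definition slope_bound_right (y : T) : R := C * h (Num.max y 0 + 1).

Definition bounded_increase (f : T -> R) : Prop :=
  forall x y, x <= y -> y - x <= 1 ->
    f y - f x <= (iota y - iota x) * slope_bound_right y.

Lemma slope_bound_right_mono x y : x <= y ->
  h (Num.max x 0 + 1) <= h (Num.max y 0 + 1).
Proof.
move=> xy; apply: hmono.
  by rewrite addr_ge0// le_max lexx orbT.
by rewrite lerD2r ge_max !le_max xy lexx orbT.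
Qed.

(** The slopes reproduce themselves: one period contributes the slope of [h], the next
    ones contribute [alpha] times the bound, and C = 1 + alpha C for
    C = 1 / (1 - alpha). *)
Lemma post_order_cost_increase f x y : below_base_stock f ->
  bounded_increase f -> x <= y -> y - x <= 1 ->
  post_order_cost f y <=
  post_order_cost f x + (iota y - iota x) * slope_bound_right y.
Proof.
move=> fW fup xy yx.
have dxy : 0 <= iota y - iota x by rewrite subr_ge0 (scale_le is_scale).
have shift t : y - t - (x - t) = y - x by ring.
have ishift t : iota (y - t) - iota (x - t) = iota y - iota x.
  by rewrite -!(scaleB is_scale) shift.
have tle t : 0 <= t -> (iota y - iota x) * h (Num.max (y - t) 0 + 1) <=
    (iota y - iota x) * h (Num.max y 0 + 1).
  by move=> t0; rewrite ler_wpM2l// slope_bound_right_mono// lerBlDr lerDl.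
have Hup : after_demand X h y <=
    (iota y - iota x) * h (Num.max y 0 + 1) + after_demand X h x.
  apply: (after_demand_mono X_ge0) => // t t0.
  have := @holding_incr _ _ _ _ is_scale _ h_ge0 h0 h_convex (x - t) (y - t).
  by rewrite shift ishift lerD2r => /(_ xy yx); have := tle _ t0; lra_params.
have Fup : after_demand X f y <=
    (iota y - iota x) * slope_bound_right y + after_demand X f x.
  apply: (after_demand_mono X_ge0); try exact: below_base_stock_integrable.
  move=> t t0; have := fup (x - t) (y - t).
  rewrite shift ishift lerD2r => /(_ xy yx).
  rewrite /slope_bound_right; have := tle _ t0; nra_params.
rewrite /post_order_cost; move: Fup Hup; rewrite /slope_bound_right.
set hh := h _; set del := iota y - _ => Fup Hup.
have -> : del * (C * hh) = del * hh + alpha * (del * (C * hh)).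
  by rewrite mulrCA {1}C_split.
by nra_params.
Qed.

(** The infimum defining [bellman] runs over the grid only.  A quantity off the grid is
    rounded up; this changes the order cost and the subsequent cost little, the
    latter because of [bounded_increase]. *)
Lemma bellman_le f x a : below_base_stock f -> bounded_increase f -> 0 <= a ->
  bellman f x <= cost_to_go f x a.
Proof.
move=> fW fup a0; apply/ler_addgt0Pr => eps eps0.
have grid_le k : bellman f x <= cost_to_go f x (grid k).
  by apply: (@inf_seq_le _ (fun k => cost_to_go f x (grid k)) 0) => j;
    exact: cost_to_go_grid_ge0.
(* M bounds the slope of the cost to go between the orders a and a + 1. *)
pose M := cbar + C * h (Num.max (x + (a + 1)) 0 + 1).
have M0 : 0 < M by rewrite ltr_pwDl// mulr_ge0//; lra_params.
have eta0 : 0 < Num.min 1 (eps / M) by rewrite lt_min ltr01 divr_gt0.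
have [k [ak ka a0k]] := grid_dense is_scale a0 eta0.
apply: (le_trans (grid_le k)).
move: a0; rewrite le_eqVlt => /predU1P[a0|a0].
  by rewrite -a0 a0k// lerDl ltW.
have ka1 : grid k <= a + 1.
  rewrite -(scale_le is_scale) (scaleD is_scale) (scale1 is_scale).
  by rewrite (le_trans ka)// lerD2l ge_min lexx.
have kaM : iota (grid k) - iota a <= eps / M.
  by rewrite lerBlDl (le_trans ka)// lerD2l ge_min lexx orbT.
have iak : 0 <= iota (grid k) - iota a by rewrite subr_ge0 (scale_le is_scale).
rewrite /cost_to_go !order_cost_gt0//; last exact: lt_le_trans ak.
have xak : x + a <= x + grid k by rewrite lerD2l.
have xak1 : x + grid k - (x + a) <= 1 by lra.
have := post_order_cost_increase fW fup xak xak1.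
have -> : iota (x + grid k) - iota (x + a) = iota (grid k) - iota a.
  by rewrite !(scaleD is_scale); ring.
have sl : slope_bound_right (x + grid k) <= M - cbar.
  rewrite /M addrAC subrr add0r /slope_bound_right ler_wpM2l//.
    by lra_params.
  by apply: slope_bound_right_mono; rewrite lerD2l.
have eM : eps = eps / M * M by rewrite divfK// gt_eqF.
have : (iota (grid k) - iota a) * M <= eps by rewrite eM ler_pM2r.
by move: sl iak; nra_params.
Qed.

Lemma le_bellman f x r : below_base_stock f ->
  (forall a, 0 <= a -> r <= cost_to_go f x a) -> r <= bellman f x.
Proof. by move=> fW le; apply: le_inf_seq => k; apply: le; exact: grid_ge0 is_scale k. Qed.

Lemma base_stock_bound_increase : bounded_increase W.
Proof.
move=> x y xy yx; rewrite /W /base_stock_bound /slope_bound_right.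
have ixy : iota x <= iota y by rewrite (scale_le is_scale).
have sxy : shortage y <= shortage x.
  by rewrite /shortage ge_max !le_max lexx orbT andbT lerN2 ixy.
have mxy : Num.max x 0 <= Num.max y 0 by rewrite ge_max !le_max xy lexx orbT.
have m0 z : 0 <= Num.max z 0 :> T by rewrite le_max lexx orbT.
have iyx : iota (Num.max y 0) - iota (Num.max x 0) <= iota y - iota x.
  rewrite !(scale_max is_scale) (scale0 is_scale).
  by rewrite /Num.max; do 2 case: ifPn; rewrite -?leNgt; lra_params.
have yx1 : Num.max y 0 - Num.max x 0 <= 1.
  rewrite -(scale_le is_scale) (scale1 is_scale) (scaleB is_scale).
  rewrite (le_trans iyx)// -(scaleB is_scale) -(scale1 is_scale).
  by rewrite (scale_le is_scale).
have := holding_incr is_scale h_ge0 h0 h_convex mxy yx1.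
rewrite (max_l (m0 y)); move: C_ge1 => C1 inc.
have hh0 := h_ge0 (Num.max y 0 + 1).
have : C * (h (Num.max y 0) - h (Num.max x 0)) <=
    (iota y - iota x) * (C * h (Num.max y 0 + 1)).
  rewrite [leRHS]mulrCA ler_wpM2l//; first lra_params.
  by apply: (le_trans inc); rewrite ler_wpM2r.
by move: sxy cbar_gt0; nra_params.
Qed.

Lemma base_stock_bound_below : below_base_stock W.
Proof.
split; first exact: base_stock_bound_measurable.
by move=> x; rewrite base_stock_bound_ge0 lexx.
Qed.

(** Evaluate the cost of ordering up to zero from a negative stock, and of not
    ordering from a positive one. *)
Lemma bellman_base_stock x : bellman W x <= W x.
Proof.
have bl a : 0 <= a -> bellman W x <= cost_to_go W x a.
  by move=> a0; apply: bellman_le => //;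
    [exact: base_stock_bound_below|exact: base_stock_bound_increase].
have [x0|x0] := leP x 0.
  apply: (le_trans (bl (- x) _)); first by rewrite oppr_ge0.
  rewrite /cost_to_go /post_order_cost subrr.
  have ix0 : iota x <= 0 by rewrite -(scale0 is_scale) (scale_le is_scale).
  have EW : after_demand X W 0 <=
      C * (K + after_demand X h 0 + alpha * (cbar * mu)) +
      after_demand X (cst 0) 0 + cbar * after_demand X shortage 0.
    apply: (after_demand_le X_ge0 base_stock_bound_integrable
      (demand_integrable_cst _ _) shortage_int) => t t0.
    rewrite {1}/W /base_stock_bound max_r ?h0; last by lra.
    by rewrite /cst mulr0 !addr0.
  rewrite after_demand_cst addr0 -/mu in EW.
  have sx : shortage x = - iota x by rewrite /shortage max_l//; lra_params.
  rewrite {2}/W /base_stock_bound sx max_r// h0 mulr0 addr0.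
  have := order_cost_le (- x); rewrite (scaleN is_scale).
  have := ler_wpM2l alpha_ge0 EW.
  set S := K + after_demand X h 0 + _; have := C_split S.
  by rewrite /S; lra.
apply: (le_trans (bl 0 _)) => //.
rewrite /cost_to_go /post_order_cost addr0 order_cost0 add0r.
have Hx : after_demand X h x <= h x + after_demand X h 0.
  apply: (after_demand_mono X_ge0) => // t t0.
  rewrite [leRHS]addrC; apply: (holding_le_ends is_scale) => //.
  by lra.
have EW : after_demand X W x <=
    C * (K + after_demand X h 0 + alpha * (cbar * mu)) + C * h x +
    after_demand X (cst 0) 0 + cbar * after_demand X shortage 0.
  apply: (after_demand_le X_ge0 base_stock_bound_integrable
    (demand_integrable_cst _ _) shortage_int) => t t0.
  rewrite {1}/W /base_stock_bound shortage_opp//.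
  have hle : C * h (Num.max (x - t) 0) <= C * h x.
    rewrite ler_wpM2l//; first by lra_params.
    apply: hmono; first by rewrite le_max lexx orbT.
    by rewrite ge_max (ltW x0) andbT lerBlDr lerDl.
  have sle : cbar * shortage (x - t) <= cbar * iota t.
    rewrite ler_pM2l//.
    have := shortage_after x t0; rewrite {2}/shortage max_r ?add0r//.
    by rewrite oppr_le0 (scale_ge0 is_scale) ltW.
  by rewrite /cst addr0; move: hle sle; lra.
rewrite after_demand_cst addr0 -/mu in EW.
rewrite {2}/W /base_stock_bound /shortage (max_r (y := 0)); last first.
  by rewrite oppr_le0 (scale_ge0 is_scale) ltW.
rewrite mulr0 addr0 max_l; last exact: ltW.
have := ler_wpM2l alpha_ge0 EW.
set S := K + after_demand X h 0 + _.
have := C_split S; have := C_split (h x); have := K_gt0.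
by rewrite /S; lra.
Qed.

Lemma bellman_below f : below_base_stock f -> below_base_stock (bellman f).
Proof.
move=> fW; have [_ fleW] := fW; split.
  apply: (@measurable_inf_seq _ _ (stock iota)
    (fun k x => cost_to_go f x (grid k)) 0) => [k x|k].
    exact: cost_to_go_grid_ge0.
  exact: measurable_cost_to_go.
move=> x; apply/andP; split.
  by apply: le_bellman => // a; apply: cost_to_go_ge0 => y; have /andP[] := fleW y.
apply: le_trans (bellman_base_stock x).
apply: le_inf_seq => k.
apply: (@le_trans _ _ (cost_to_go f x (grid k))).
  by apply: (@inf_seq_le _ (fun k => cost_to_go f x (grid k)) 0) => j;
    exact: cost_to_go_grid_ge0.
apply: cost_to_go_mono; try exact: below_base_stock_integrable.
  exact: base_stock_bound_integrable.
by move=> y; have /andP[] := fleW y.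
Qed.

(** From the higher stock [y], imitate the lower stock [x]: if the order exceeds the
    difference, order that much less and reach the same level at a smaller cost;
    otherwise do not order, and keep an advance of at most [y - x]. *)
Lemma bellman_increase f : below_base_stock f -> bounded_increase f ->
  bounded_increase (bellman f).
Proof.
move=> fW fup x y xy yx; rewrite lerBlDr -lerBlDl.
apply: le_bellman => // a a0; rewrite lerBlDl.
have [ax|ax] := leP (y - x) a.
  apply: (le_trans (bellman_le y fW fup (_ : 0 <= a - (y - x)))).
    by rewrite subr_ge0.
  rewrite /cost_to_go (_ : y + (a - (y - x)) = x + a); last by ring.
  have : order_cost (a - (y - x)) <= order_cost a.
    by apply: order_cost_mono; [rewrite subr_ge0|rewrite lerBlDr lerDl subr_ge0].
  have : 0 <= (iota y - iota x) * slope_bound_right y.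
    apply: mulr_ge0; first by rewrite subr_ge0 (scale_le is_scale).
    by rewrite mulr_ge0//; lra_params.
  by lra_params.
apply: (le_trans (bellman_le y fW fup (lexx 0))).
rewrite /cost_to_go order_cost0 add0r addr0.
have xay : x + a <= y by lra.
have xay1 : y - (x + a) <= 1 by lra.
have := post_order_cost_increase fW fup xay xay1; rewrite (scaleD is_scale).
have := order_cost_ge0 a0.
have : 0 <= slope_bound_right y by rewrite mulr_ge0//; lra_params.
move: a0; rewrite -(scale_ge0 is_scale); nra_params.
Qed.

Section bounded_decrease.
Context (B b : T).
Hypothesis B_gt0 : 0 < B.

Let beta : R := C * (alpha * mu).

Let stretch (z : T) : R := h (z + (- B - 1)) + h (z + b).

(** A unit cost for making up the difference at some later order, and the slope of
    [h] on the stocks between [- B] and [b], summed over all periods with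
    discount.  The slope is not bounded on all stocks, so that it is used only as long
    as the stock stays above [- B]. *)
Definition slope_bound_left : R := C * (cbar + after_demand X stretch 0).

(** An upper bound for the expected discounted fixed cost of one additional order,
    placed when the stock falls below [- B].  It is at least [K] there, its
    discounted expectation decreases along the process without orders, and it tends
    to zero as [B] grows. *)
Definition emergency_cost (y : T) : R := K / iota B * (beta + shortage y).

Definition bounded_decrease (f : T -> R) : Prop :=
  forall x y, x <= y -> y <= b -> y - x <= 1 ->
    f x - f y <= (iota y - iota x) * slope_bound_left + emergency_cost y.

Let stretch_int : demand_integrable X stretch.
Proof. by apply: demand_integrableD; exact: (demand_integrable_shift is_scale). Qed.

Let stretch_ge0 : 0 <= after_demand X stretch 0.
Proof. by apply: after_demand_ge0 => y; exact: addr_ge0. Qed.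

Let iB : 0 < iota B. Proof. by rewrite (scale_gt0 is_scale). Qed.

Let beta_ge0 : 0 <= beta.
Proof. by do !apply: mulr_ge0 => //; lra_params. Qed.

Lemma slope_bound_left_ge : cbar <= slope_bound_left.
Proof.
by rewrite /slope_bound_left; move: C_ge1 stretch_ge0 cbar_gt0; nra_params.
Qed.

Lemma emergency_cost_ge0 y : 0 <= emergency_cost y.
Proof.
apply: mulr_ge0; first by rewrite divr_ge0 ?ltW.
by rewrite addr_ge0// shortage_ge0.
Qed.

(** The constant in [emergency_cost] solves beta = alpha (beta + mu), where mu is the mean
    demand. *)
Lemma emergency_cost_after y :
  alpha * (K / iota B * (beta + after_demand X shortage y)) <= emergency_cost y.
Proof.
rewrite mulrCA /emergency_cost ler_wpM2l//; first by rewrite divr_ge0 ?ltW.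
have := after_demand_shortage y; have := shortage_ge0 y.
have : alpha * beta + alpha * mu = beta.
  by rewrite /beta [RHS]C_split addrC.
by nra_params.
Qed.

Lemma post_order_cost_decrease f x y : below_base_stock f ->
  bounded_decrease f -> x <= y -> - B <= y -> y <= b -> y - x <= 1 ->
  post_order_cost f x <= post_order_cost f y +
    (iota y - iota x) * slope_bound_left + emergency_cost y.
Proof.
move=> fW fdown xy By yb yx.
have dxy : 0 <= iota y - iota x by rewrite subr_ge0 (scale_le is_scale).
have shift t : y - t - (x - t) = y - x by ring.
have ishift t : iota (y - t) - iota (x - t) = iota y - iota x.
  by rewrite -!(scaleB is_scale) shift.
have Hdown : after_demand X h x <= 0 + after_demand X h y +
    (iota y - iota x) * after_demand X stretch 0.
  apply: (after_demand_le X_ge0) => // t t0.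
  have := @holding_decr _ _ _ _ is_scale _ h_ge0 h_convex (x - t) (y - t).
  rewrite shift ishift lerD2r => /(_ xy yx).
  have : h (y - t - 1) <= stretch (0 - t).
    by apply: (holding_le_ends is_scale) => //; lra.
  by move: dxy; nra_params.
have Fdown : after_demand X f x <=
    ((iota y - iota x) * slope_bound_left + K / iota B * beta) +
    after_demand X f y + K / iota B * after_demand X shortage y.
  apply: (after_demand_le X_ge0) => //; try exact: below_base_stock_integrable.
  move=> t t0; have := fdown (x - t) (y - t).
  have ytb : y - t <= b by rewrite lerBlDr (le_trans yb)// lerDl.
  rewrite shift ishift lerD2r => /(_ xy ytb yx).
  by rewrite /emergency_cost; lra_params.
have := emergency_cost_after y.
rewrite /post_order_cost; move: Hdown Fdown.
have := slope_bound_left_ge.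
have : slope_bound_left = cbar + after_demand X stretch 0 + alpha * slope_bound_left.
  by rewrite /slope_bound_left -C_split.
move: (K / iota B) => kb.
move: slope_bound_left (emergency_cost y) (after_demand X stretch 0) => s e st.
move=> sE scbar Hdown Fdown ee.
have : alpha * after_demand X f x <= alpha * (((iota y - iota x) * s + kb * beta) +
    after_demand X f y + kb * after_demand X shortage y).
  by rewrite ler_wpM2l//; lra_params.
have : (iota y - iota x) * s = (iota y - iota x) * cbar + (iota y - iota x) * st +
    alpha * ((iota y - iota x) * s) by rewrite {1}sE; ring.
have : 0 <= (iota y - iota x) * cbar by rewrite mulr_ge0// ltW.
by lra_params.
Qed.

(** From the lower stock [x], imitate the higher stock [y]: add the difference to a
    positive order, at the unit cost only.  If no order is placed from [y], do not
    order either and keep the delay, unless [y] is below [- B], in which case the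
    difference is ordered at once and the fixed cost is paid by
    [emergency_cost]. *)
Lemma bellman_decrease f : below_base_stock f -> bounded_increase f ->
  bounded_decrease f -> bounded_decrease (bellman f).
Proof.
move=> fW fup fdown x y xy yb yx; rewrite lerBlDr -lerBlDl.
apply: le_bellman => // a a0; rewrite lerBlDl.
have dxy : 0 <= iota y - iota x by rewrite subr_ge0 (scale_le is_scale).
have e0 := emergency_cost_ge0 y; have s0 := slope_bound_left_ge.
have cs : (iota y - iota x) * cbar <= (iota y - iota x) * slope_bound_left.
  by rewrite ler_wpM2l.
move: a0; rewrite le_eqVlt => /predU1P[<-|a0].
  have [By|By] := leP (- B) y.
    apply: (le_trans (bellman_le x fW fup (lexx 0))).
    rewrite /cost_to_go order_cost0 !add0r !addr0.
    by have := post_order_cost_decrease fW fdown xy By yb yx; lra_params.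
  apply: (le_trans (bellman_le x fW fup (_ : 0 <= y - x))); first by rewrite subr_ge0.
  rewrite /cost_to_go order_cost0 add0r addr0 subrKC.
  have := order_cost_le (y - x).
  rewrite (scaleB is_scale).
  suff : K <= emergency_cost y by lra_params.
  rewrite /emergency_cost -mulrA ler_pMr// mulrC ler_pdivlMr// mul1r.
  have : iota B <= shortage y.
    by rewrite /shortage le_max -(scaleN is_scale) (scale_le is_scale) lerNr ltW.
  by move: beta_ge0; lra_params.
have a1 : 0 < a + (y - x) by rewrite ltr_wpDr ?subr_ge0.
apply: (le_trans (bellman_le x fW fup (ltW a1))).
rewrite /cost_to_go (_ : x + (a + (y - x)) = y + a); last by ring.
rewrite !order_cost_gt0// (scaleD is_scale) (scaleB is_scale).
by move: cs; lra_params.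
Qed.

Lemma base_stock_bound_decrease : bounded_decrease W.
Proof.
move=> x y xy yb yx; rewrite /W /base_stock_bound.
have dxy : 0 <= iota y - iota x by rewrite subr_ge0 (scale_le is_scale).
have : h (Num.max x 0) <= h (Num.max y 0).
  apply: hmono; first by rewrite le_max lexx orbT.
  by rewrite ge_max !le_max xy lexx orbT.
have := shortage_sub xy.
have := emergency_cost_ge0 y; have := slope_bound_left_ge.
by nra_params.
Qed.

End bounded_decrease.

(** The iteration starts above the fixed point.  It therefore decreases, the limit is an
    infimum, and infima over the iterates and over the order quantities commute. *)
Definition value_iterate (n : nat) : T -> R := iter n bellman W.

Definition value (x : T) : R := inf (range (value_iterate ^~ x)).

Lemma value_iterate_below n :
  below_base_stock (value_iterate n) /\ bounded_increase (value_iterate n).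
Proof.
elim: n => [|n [IHb IHi]].
  by split; [exact: base_stock_bound_below|exact: base_stock_bound_increase].
by split; [exact: bellman_below|exact: bellman_increase].
Qed.

Lemma value_iterate_decrease B b n : 0 < B -> bounded_decrease B b (value_iterate n).
Proof.
move=> B0; elim: n => [|n IH]; first exact: base_stock_bound_decrease.
by have [? ?] := value_iterate_below n; exact: bellman_decrease.
Qed.

Lemma value_iterate_ge0 n x : 0 <= value_iterate n x.
Proof. by have [[_ /(_ x) /andP[]]] := value_iterate_below n. Qed.

Lemma value_iterate_nonincreasing x : nonincreasing_seq (value_iterate ^~ x).
Proof.
apply/nonincreasing_seqP => n; elim: n x => [|n IH] x; first exact: bellman_base_stock.
have [bn _] := value_iterate_below n; have [bn1 _] := value_iterate_below n.+1.
apply: le_inf_seq => k.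
apply: (@le_trans _ _ (cost_to_go (value_iterate n.+1) x (grid k))).
  by apply: (@inf_seq_le _ (fun k => cost_to_go _ x (grid k)) 0) => j;
    exact: cost_to_go_grid_ge0.
by apply: cost_to_go_mono; rewrite //; exact: below_base_stock_integrable.
Qed.

Lemma value_le_iterate n x : value x <= value_iterate n x.
Proof.
by apply: (@inf_seq_le _ (value_iterate ^~ x) 0) => m; exact: value_iterate_ge0.
Qed.

Lemma value_cvg x : value_iterate n x @[n --> \oo] --> value x.
Proof.
apply: nonincreasing_cvgn; first exact: value_iterate_nonincreasing.
by exists 0 => _ [n _ <-]; exact: value_iterate_ge0.
Qed.

Lemma value_below : below_base_stock value.
Proof.
split.
  apply: (@measurable_inf_seq _ _ (stock iota) value_iterate 0) => [n x|n].
    exact: value_iterate_ge0.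
  by have [[]] := value_iterate_below n.
move=> x; apply/andP; split; first by apply: le_inf_seq => n; exact: value_iterate_ge0.
exact: (value_le_iterate 0).
Qed.

Lemma value_increase : bounded_increase value.
Proof.
move=> x y xy yx; rewrite lerBlDr -lerBlDl; apply: le_inf_seq => n.
rewrite lerBlDl; apply: (le_trans (value_le_iterate n y)).
by rewrite -lerBlDr; have [_] := value_iterate_below n; apply.
Qed.

Lemma value_decrease B b : 0 < B -> bounded_decrease B b value.
Proof.
move=> B0 x y xy yb yx; rewrite lerBlDr -lerBlDl; apply: le_inf_seq => n.
rewrite lerBlDl; apply: (le_trans (value_le_iterate n x)).
by rewrite -lerBlDr; apply: value_iterate_decrease.
Qed.

(** The [n.+1]-st iterate is below the cost to go for the [n]-th one, which
    converges by dominated convergence. *)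
Lemma value_le_cost_to_go x a : 0 <= a -> value x <= cost_to_go value x a.
Proof.
move=> a0.
have cv : cost_to_go (value_iterate n) x a @[n --> \oo] --> cost_to_go value x a.
  apply: cvgD; first exact: cvg_cst.
  apply: cvgD; first exact: cvg_cst.
  apply: cvgM; first exact: cvg_cst.
  apply: (after_demand_cvg is_scale _ _ _ base_stock_bound_integrable).
  - by move=> n; have [[]] := value_iterate_below n.
  - by move=> n y; have [[_ /(_ y)]] := value_iterate_below n.
  - by have [] := value_below.
  - exact: value_cvg.
rewrite -(cvg_lim _ cv)//; apply: limr_ge; first by apply/cvg_ex; eexists; exact: cv.
apply: nearW => n; have [bn inn] := value_iterate_below n.
exact: le_trans (value_le_iterate n.+1 x) (bellman_le x bn inn a0).
Qed.

(** The cost to go for the limit is below the one for each iterate, hence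
    [bellman value] is below each iterate. *)
Lemma value_near_optimal x eps : 0 < eps ->
  exists k, cost_to_go value x (grid k) < value x + eps.
Proof.
move=> eps0; have grid0 k := cost_to_go_grid_ge0 x k value_below.
have [k kle] := inf_seq_near grid0 eps0.
exists k; apply: (lt_le_trans kle); rewrite lerD2r.
apply: le_inf_seq => n; have [bn _] := value_iterate_below n.
apply: le_trans (value_iterate_nonincreasing x (leqnSn n)).
apply: le_inf_seq => j; apply: le_trans (inf_seq_le grid0 j) _.
apply: cost_to_go_mono; try exact: below_base_stock_integrable.
  exact: (below_base_stock_integrable value_below).
by move=> y; exact: value_le_iterate.
Qed.

(** Lipschitz on bounded sets up to an arbitrarily small constant, for steps of
    length at most 1.  The formulation covers the real line and the integers and is
    stable under sums. *)
Definition locally_controlled (f : T -> R) : Prop :=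
  forall (b : T) eps, 0 < b -> 0 < eps -> exists2 L : R, 0 <= L &
    forall x y, x <= y -> - b <= y -> y <= b -> y - x <= 1 ->
      `|f y - f x| <= L * (iota y - iota x) + eps.

(** For given [b] and [eps], a large [B] makes the emergency cost at most [eps] on the
    stocks above [- b]. *)
Lemma one_sided_bounds_controlled f M :
  (forall b x y, x <= y -> y <= b -> y - x <= 1 ->
    f y - f x <= (iota y - iota x) * M b) ->
  (forall B b, 0 < B -> exists L, forall x y, x <= y -> - B <= y -> y <= b ->
    y - x <= 1 -> f x - f y <= (iota y - iota x) * L + emergency_cost B y) ->
  locally_controlled f.
Proof.
move=> up down b eps b0 eps0.
have ib : 0 < iota b by rewrite (scale_gt0 is_scale).
(* On stocks between - b and b the emergency cost is at most eps as soon as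
   iota B >= N. *)
pose N := K * (C * (alpha * mu) + iota b) / eps.
pose n := (Num.truncn `|N|).+1.
have nN : N <= n%:R by rewrite (le_trans (ler_norm _))// ltW// truncnS_gt.
have n0 : (0 : T) < n%:R by rewrite ltr0n.
have [L Ldown] := down (n%:R + b) b (addr_gt0 n0 b0).
exists (`|L| + `|M b|); first by rewrite addr_ge0.
move=> x y xy by' yb yx.
have dxy : 0 <= iota y - iota x by rewrite subr_ge0 (scale_le is_scale).
have em : emergency_cost (n%:R + b) y <= eps.
  rewrite /emergency_cost (scaleD is_scale) (scale_nat is_scale).
  have nb : 0 < n%:R + iota b :> R by rewrite addr_gt0// ltr0n.
  rewrite mulrAC ler_pdivrMr//.
  have sy : shortage y <= iota b.
    rewrite /shortage ge_max (ltW ib) andbT -(scaleN is_scale).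
    by rewrite (scale_le is_scale) lerNl.
  have : K * (C * (alpha * mu) + shortage y) <= K * (C * (alpha * mu) + iota b).
    by rewrite ler_pM2l// lerD2l.
  move=> /le_trans; apply.
  move: nN; rewrite /N ler_pdivrMr// => /le_trans; apply.
  by rewrite mulrC ler_wpM2l ?(ltW eps0)// lerDl ltW.
have nby : - (n%:R + b) <= y.
  by rewrite (le_trans _ by')// lerN2 lerDr ltW.
have hdown := Ldown x y xy nby yb yx; have hup := up b x y xy yb yx.
have := ler_norm L; have := ler_norm (M b).
have := normr_ge0 L; have := normr_ge0 (M b).
by rewrite ler_norml; nra.
Qed.

Lemma value_controlled : locally_controlled value.
Proof.
apply: (@one_sided_bounds_controlled _ slope_bound_right) => [b x y xy yb yx|B b B0].
  apply: (le_trans (value_increase xy yx)); rewrite ler_wpM2l//.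
    by rewrite subr_ge0 (scale_le is_scale).
  by rewrite ler_wpM2l ?slope_bound_right_mono//; lra_params.
by exists (slope_bound_left B b) => x y xy _; exact: value_decrease.
Qed.

Lemma post_order_cost_controlled : locally_controlled (post_order_cost value).
Proof.
apply: (@one_sided_bounds_controlled _ slope_bound_right) => [b x y xy yb yx|B b B0].
  rewrite lerBlDl.
  apply: (le_trans (post_order_cost_increase value_below value_increase xy yx)).
  rewrite lerD2l ler_wpM2l//; first by rewrite subr_ge0 (scale_le is_scale).
  by rewrite ler_wpM2l ?slope_bound_right_mono//; lra_params.
exists (slope_bound_left B b) => x y xy By yb yx; rewrite lerBlDl addrA.
exact: (post_order_cost_decrease B0 value_below (value_decrease B0)).
Qed.

End dynamic_programming.

(** * Continuity *)

Section continuity.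
Context (R : realType) (T : realDomainType) (iota : T -> R) (grid : nat -> T).
Hypothesis is_scale : inventory_scale iota grid.

Lemma controlled_continuous (f : T -> R) : locally_controlled iota f ->
  continuous (EFin \o f : initial_topology iota -> \bar R).
Proof.
move=> fc x.
have FF : Filter (nbhs (x : initial_topology iota)) by exact: nbhs_filter.
apply/(@fine_cvgP _ _ _ FF); split; first by apply: nearW.
apply/cvgrPdist_le => eps eps0.
pose n := (Num.truncn (`|iota x| + 1)).+1.
have nx : `|iota x| + 1 < n%:R by rewrite truncnS_gt.
have n0 : (0 : T) < n%:R by rewrite ltr0n.
have e2 : 0 < eps / 2 by rewrite divr_gt0.
have [L L0 hL] := fc n%:R (eps / 2) n0 e2.
pose del := Num.min 1 (eps / 2 / (L + 1)).
have L1 : 0 < L + 1 by lra.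
have del0 : 0 < del by rewrite lt_min ltr01 divr_gt0.
have : \forall y \near (x : initial_topology iota), `|iota x - iota y| < del.
  have /cvgrPdist_lt/(_ _ del0) := @initial_continuous _ _ iota x.
  exact.
apply: filterS => y xy /=.
have [d1 dL] : del <= 1 /\ L * del <= eps / 2.
  split; first by rewrite ge_min lexx.
  have : del * (L + 1) <= eps / 2 by rewrite -ler_pdivlMr// ge_min lexx orbT.
  by nra.
have absy : - n%:R <= y <= n%:R.
  rewrite -!(scale_le is_scale) (scaleN is_scale) (scale_nat is_scale).
  have := ler_norm (iota x); have := ler_norm (- iota x); rewrite normrN.
  by move: xy; rewrite ltr_norml => /andP[]; lra.
have absx : - n%:R <= x <= n%:R.
  rewrite -!(scale_le is_scale) (scaleN is_scale) (scale_nat is_scale).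
  by have := ler_norm (iota x); have := ler_norm (- iota x); rewrite normrN; lra.
have [lexy|ltyx] := leP x y.
  have yx1 : y - x <= 1.
    rewrite -(scale_le is_scale) (scale1 is_scale) (scaleB is_scale).
    by move: xy; rewrite ltr_norml => /andP[]; lra.
  move: absx absy => /andP[nlex lexn] /andP[nley leyn].
  have := hL _ _ lexy nley leyn yx1.
  by rewrite distrC; move: xy; rewrite ltr_norml => /andP[]; nra.
have yx1 : x - y <= 1.
  rewrite -(scale_le is_scale) (scale1 is_scale) (scaleB is_scale).
  by move: xy; rewrite ltr_norml => /andP[]; lra.
move: absx absy => /andP[nlex lexn] /andP[nley leyn].
have := hL _ _ (ltW ltyx) nlex lexn yx1.
by move: xy; rewrite ltr_norml => /andP[]; nra.
Qed.

Lemma linear_controlled (c : R) : locally_controlled iota (fun x => c * iota x).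
Proof.
move=> b eps b0 eps0; exists `|c| => // x y xy _ _ _.
have dxy : 0 <= iota y - iota x by rewrite subr_ge0 (scale_le is_scale).
by rewrite -mulrBr normrM (ger0_norm dxy) lerDl ltW.
Qed.

Lemma controlledD f g : locally_controlled iota f -> locally_controlled iota g ->
  locally_controlled iota (fun x => f x + g x).
Proof.
move=> fc gc b eps b0 eps0; have e2 : 0 < eps / 2 by rewrite divr_gt0.
have [L L0 hL] := fc b _ b0 e2; have [M M0 hM] := gc b _ b0 e2.
exists (L + M); first exact: addr_ge0.
move=> x y xy By yb yx.
have := hL x y xy By yb yx; have := hM x y xy By yb yx.
have := ler_normD (f y - f x) (g y - g x).
rewrite (_ : f y - f x + (g y - g x) = f y + g y - (f x + g x)); last by ring.
by lra.
Qed.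

End continuity.

(** * Transitions of the controlled process *)

Section controlled_process.
Context (R : realType) (T : realDomainType) (iota : T -> R) (grid : nat -> T).
Hypothesis is_scale : inventory_scale iota grid.
Context (d : measure_display) (Omega : measurableType d).
Context (P : probability Omega R) (D : nat -> {RV P >-> stock iota}).
Hypothesis D_iid : identically_distributed D.

Lemma measurable_at t : measurable_fun setT
  ((fun w => w t) : trajectory iota -> (stock iota * order_quantity iota)%type).
Proof.
move=> _ B mB; apply: sub_sigma_algebra; exists t => //.
by exists B.
Qed.

Lemma measurable_state_at t :
  measurable_fun setT (@state_at R T iota t : _ -> stock iota).
Proof. exact: (measurableT_comp measurable_fst (measurable_at t)). Qed.

Lemma measurable_action_at t :
  measurable_fun setT (@action_at R T iota t : _ -> order_quantity iota).
Proof. exact: (measurableT_comp measurable_snd (measurable_at t)). Qed.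

Lemma measurable_amount_at t :
  measurable_fun setT ((fun w => amount (action_at t w)) : trajectory iota -> stock iota).
Proof.
apply: (@measurableT_comp _ _ _ _ _ _ (@amount R T iota : _ -> stock iota)).
  exact: measurable_amount.
exact: measurable_action_at.
Qed.

Lemma measurable_post_order t : measurable_fun setT
  ((fun w => (state_at t w : T) + amount (action_at t w)) : trajectory iota -> stock iota).
Proof.
by apply: (measurable_stockD is_scale);
  [exact: measurable_state_at|exact: measurable_amount_at].
Qed.

(** Expectations depend on a demand only through its law. *)
Lemma demand_mean_iid (g : T -> R) t y :
  measurable_fun setT (g : stock iota -> R) -> (forall z, 0 <= g z) ->
  (\int[P]_u (g (y - D t u))%:E = \int[P]_u (g (y - D 0 u))%:E)%E.
Proof.
move=> mg g0.
have mgy : measurable_fun setT ((fun z => (g (y - z))%:E) : stock iota -> \bar R).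
  apply/measurable_EFinP; apply: (measurableT_comp mg).
  by apply: (measurable_stockB is_scale) => //; exact: measurable_cst.
have E s : (\int[P]_u (g (y - D s u))%:E =
    \int[distribution P (D s)]_z ((fun z : stock iota => (g (y - z))%:E) z))%E.
  by rewrite ge0_integral_distribution// => z; rewrite lee_fin.
by rewrite !E; apply: eq_measure_integral => A mA _; exact: D_iid.
Qed.

Section strategic.
Context (pi : policy iota) (x : T) (Q : probability (trajectory iota) R).
Hypothesis strategic : strategic_measure D pi x Q.

(** The third condition of [strategic_measure] says that the law of the next stock is the
    image of the product of [Q] and [P]; integrate [g] against both laws and apply
    Tonelli's theorem. *)
Lemma transition_mean (g : T -> R) t :
  demand_integrable (D 0) g -> (forall z, 0 <= g z) ->
  (\int[Q]_w (g (state_at t.+1 w))%:E = \int[Q]_w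
    (after_demand (D 0) g ((state_at t w : T) + amount (action_at t w)))%:E)%E.
Proof.
move=> gi g0; have [mg _] := gi.
pose phi (wu : trajectory iota * Omega) : stock iota :=
  next_state D t (state_at t wu.1) (action_at t wu.1) wu.2.
have mphi : measurable_fun setT phi.
  apply: (measurable_stockB is_scale).
    exact: (measurableT_comp (measurable_post_order t)).
  by apply: measurableT_comp => //; exact: measurable_funP.
have mgE : measurable_fun setT ((fun z => (g z)%:E) : stock iota -> \bar R).
  exact/measurable_EFinP.
have law : (\int[pushforward Q (@state_at R T iota t.+1)]_z (g z)%:E =
    \int[pushforward (Q \x P) phi]_z (g z)%:E)%E.
  apply: eq_measure_integral; first exact: measurable_state_at.
  move=> mst C mC _; rewrite /=.
  have [_ _ /(_ t setT C measurableT mC)] := strategic.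
  rewrite /pushforward (_ : [set w | _] = @state_at R T iota t.+1 @^-1` C); last first.
    by apply/seteqP; split=> [w []|w].
  rewrite (_ : [set w | _] = setT); last by apply/seteqP.
  move=> ->; rewrite /= /product_measure1; apply: eq_integral => w _ /=.
  by congr (P _); apply/seteqP; split=> u; rewrite /xsection/= inE.
transitivity (\int[pushforward Q (@state_at R T iota t.+1)]_z (g z)%:E)%E.
  rewrite ge0_integral_pushforward//; first exact: measurable_state_at.
  by move=> z _; rewrite lee_fin.
rewrite law ge0_integral_pushforward//; last by move=> z _; rewrite lee_fin.
rewrite preimage_setT fubini_tonelli1//=; last 2 first.
- exact: (measurableT_comp mgE).
- by move=> wu; rewrite lee_fin.
apply: eq_integral => w _; rewrite /fubini_F /phi /next_state /demand /=.
by rewrite demand_mean_iid// after_demand_fin.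
Qed.

Lemma initial_mean (g : T -> R) :
  measurable_fun setT (g : stock iota -> R) ->
  (\int[Q]_w (g (state_at 0 w))%:E = (g x)%:E)%E.
Proof.
move=> mg; have [start _ _] := strategic.
have mS : measurable [set w : trajectory iota | state_at 0 w = x].
  have := measurable_state_at 0 measurableT (measurable_stock1 is_scale x).
  by rewrite setTI.
transitivity (\int[Q]_w ((cst (g x)%:E) w))%E; last first.
  by rewrite integral_cst// [X in (_ * X)%E](probability_setT Q) mule1.
apply: ae_eq_integral => //.
  apply/measurable_EFinP; apply: (measurableT_comp mg).
  exact: measurable_state_at.
exists (~` [set w : trajectory iota | state_at 0 w = x]); split.
- exact: (measurableC mS).
- by have := probability_setC Q mS; rewrite start subee // => ->.
- by move=> w /= nw eqx; apply: nw => _; rewrite eqx.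
Qed.

End strategic.
End controlled_process.

(** * Verification by sub- and supersolutions *)

Section verification.
Context (R : realType) (T : realDomainType) (iota : T -> R) (grid : nat -> T).
Hypothesis is_scale : inventory_scale iota grid.
Context (d : measure_display) (Omega : measurableType d).
Context (P : probability Omega R) (D : nat -> {RV P >-> stock iota}).
Hypothesis D_iid : identically_distributed D.
Context (h : T -> R) (K cbar alpha : R).
Hypotheses (K_gt0 : 0 < K) (cbar_gt0 : 0 < cbar).
Hypotheses (alpha_ge0 : 0 <= alpha) (alpha_lt1 : alpha < 1).
Hypotheses (h_ge0 : forall x, 0 <= h x) (h_int : demand_integrable (D 0) h).

Definition stage_cost (x a : T) : R :=
  order_cost iota K cbar a + after_demand (D 0) h (x + a).

Lemma expected_holding_costE x :
  expected_holding_cost D h x = (after_demand (D 0) h x)%:E.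
Proof. by rewrite /expected_holding_cost unlock -after_demand_fin. Qed.

Lemma one_step_costE x (a : order_quantity iota) :
  one_step_cost D h K cbar x a = (stage_cost x (amount a))%:E.
Proof. by rewrite /one_step_cost expected_holding_costE. Qed.

Lemma amount_ge0 (a : order_quantity iota) : 0 <= amount a.
Proof. exact: (svalP a). Qed.

Lemma stage_cost_ge0 x (a : order_quantity iota) : 0 <= stage_cost x (amount a).
Proof.
rewrite addr_ge0 ?after_demand_ge0//.
exact: (order_cost_ge0 is_scale K_gt0 cbar_gt0 (amount_ge0 a)).
Qed.

Lemma measurable_order_cost :
  measurable_fun setT (order_cost iota K cbar : stock iota -> R).
Proof.
apply: measurable_funD; last first.
  apply: measurable_funM => //; apply: measurable_scale.
apply: measurable_funM => //.
rewrite (_ : (fun x : stock iota => _) = \1_[set x : stock iota | 0 < (x : T)]).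
  apply: measurable_indic; apply: (stock_convex_set_measurable is_scale).
  by move=> x y z /= x0 _ /andP[xz _]; exact: lt_le_trans xz.
by apply/funext => x; rewrite indicE mem_setE.
Qed.

Lemma measurable_stage_cost t : measurable_fun setT
  ((fun w => stage_cost (state_at t w) (amount (action_at t w))) :
   trajectory iota -> R).
Proof.
have [mh _] := h_int.
apply: measurable_funD.
  exact: (measurableT_comp measurable_order_cost (measurable_amount_at t)).
apply: (measurableT_comp (measurable_after_demand is_scale (D 0) mh h_ge0)).
exact: (measurable_post_order is_scale).
Qed.

Definition mean_stage_cost (Q : probability (trajectory iota) R) (t : nat) : \bar R :=
  (\int[Q]_w (stage_cost (state_at t w) (amount (action_at t w)))%:E)%E.

Lemma mean_stage_cost_ge0 Q t : (0 <= mean_stage_cost Q t)%E.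
Proof. by apply: integral_ge0 => w _; rewrite lee_fin stage_cost_ge0. Qed.

Lemma expected_discounted_costE (Q : probability (trajectory iota) R) :
  expected_discounted_cost D h K cbar alpha Q =
  (\sum_(0 <= t <oo) (alpha ^+ t)%:E * mean_stage_cost Q t)%E.
Proof.
transitivity (\int[Q]_w \sum_(0 <= t <oo) ((alpha ^+ t)%:E *
    (stage_cost (state_at t w) (amount (action_at t w)))%:E))%E.
  apply: eq_integral => w _; apply: eq_eseriesr => t _.
  by congr (_ * _)%E; exact: one_step_costE.
rewrite integral_nneseries//=; last 2 first.
- move=> t; apply: measurable_funeM.
  by apply/measurable_EFinP; exact: measurable_stage_cost.
- move=> t w _; rewrite -EFinM lee_fin mulr_ge0 ?exprn_ge0//.
  exact: stage_cost_ge0.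
apply: eq_eseriesr => t _.
rewrite ge0_integralZl_EFin//; last by rewrite exprn_ge0.
- by move=> w _; rewrite lee_fin stage_cost_ge0.
- by apply/measurable_EFinP; exact: measurable_stage_cost.
Qed.

Section bounds.
Context (V : T -> R).
Hypotheses (V_ge0 : forall x, 0 <= V x) (V_int : demand_integrable (D 0) V).
Context (pi : policy iota) (x : T) (Q : probability (trajectory iota) R).
Hypothesis strategic : strategic_measure D pi x Q.

Let measurable_V t : measurable_fun setT
  ((fun w => (V (state_at t w))%:E) : trajectory iota -> \bar R).
Proof.
have [mV _] := V_int.
by apply/measurable_EFinP; apply: (measurableT_comp mV); exact: measurable_state_at.
Qed.

Let measurable_post_V t : measurable_fun setT
  ((fun w => (after_demand (D 0) V (state_at t w + amount (action_at t w)))%:E) :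
   trajectory iota -> \bar R).
Proof.
have [mV _] := V_int; apply/measurable_EFinP.
apply: (measurableT_comp (measurable_after_demand is_scale (D 0) mV V_ge0)).
exact: (measurable_post_order is_scale).
Qed.

Lemma mean_cost_to_go t :
  (\int[Q]_w (cost_to_go (D 0) h K cbar alpha V
     (state_at t w) (amount (action_at t w)))%:E =
   mean_stage_cost Q t + alpha%:E * \int[Q]_w (V (state_at t.+1 w))%:E)%E.
Proof.
rewrite (transition_mean is_scale D_iid strategic)//.
rewrite -ge0_integralZl_EFin//; last by move=> w _; rewrite lee_fin after_demand_ge0.
rewrite -ge0_integralD//=.
- by apply: eq_integral => w _; rewrite /cost_to_go /post_order_cost addrA EFinD EFinM.
- by move=> w _; rewrite lee_fin stage_cost_ge0.
- by apply/measurable_EFinP; exact: measurable_stage_cost.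
- by move=> w _; rewrite -EFinM lee_fin mulr_ge0// after_demand_ge0.
- by apply: emeasurable_funM.
Qed.

Lemma measurable_cost_to_go_at t : measurable_fun setT
  ((fun w => (cost_to_go (D 0) h K cbar alpha V
     (state_at t w) (amount (action_at t w)))%:E) : trajectory iota -> \bar R).
Proof.
have [mV _] := V_int.
apply/measurable_EFinP; rewrite (_ : (fun w => _) = fun w : trajectory iota =>
  stage_cost (state_at t w) (amount (action_at t w)) +
  alpha * after_demand (D 0) V ((state_at t w : T) + amount (action_at t w))).
  apply: measurable_funD; first exact: measurable_stage_cost.
  apply: measurable_funM => //.
  apply: (measurableT_comp (measurable_after_demand is_scale (D 0) mV V_ge0)).
  exact: (measurable_post_order is_scale).
by apply/funext => w; rewrite /cost_to_go /post_order_cost addrA.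
Qed.

Lemma subsolution_partial_sums n :
  (forall y a, 0 <= a -> V y <= cost_to_go (D 0) h K cbar alpha V y a) ->
  ((V x)%:E <= \sum_(0 <= t < n) (alpha ^+ t)%:E * mean_stage_cost Q t +
               (alpha ^+ n)%:E * \int[Q]_w (V (state_at n w))%:E)%E.
Proof.
move=> Vsub; elim: n => [|n IH].
  have [mV _] := V_int.
  by rewrite big_nil add0e expr0 mul1e (initial_mean is_scale strategic).
rewrite big_nat_recr//= -addeA; apply: (le_trans IH).
apply: leeD => //.
rewrite exprSr EFinM -muleA -ge0_muleDr ?mean_stage_cost_ge0//; last first.
  by rewrite mule_ge0// integral_ge0// => w _; rewrite lee_fin.
rewrite lee_wpmul2l ?lee_fin ?exprn_ge0// -mean_cost_to_go.
apply: ge0_le_integral => //=.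
- by move=> w _; rewrite lee_fin.
- exact: measurable_cost_to_go_at.
- by move=> w _; rewrite lee_fin Vsub// amount_ge0.
Qed.

(** Iterating the inequality for [V] along the process bounds [V x] by the cost of [n]
    periods plus the discounted mean of [V] at time [n].  This remainder vanishes when
    the total cost is finite: [V] grows at most like [h], and the mean of [h] at time
    [n.+1] is at most the mean cost of period [n], the term of a convergent series. *)
Lemma subsolution_le_cost (a c : R) : 0 <= a -> 0 <= c ->
  (forall y b, 0 <= b -> V y <= cost_to_go (D 0) h K cbar alpha V y b) ->
  (forall y, V y <= a + c * h y) ->
  ((V x)%:E <= expected_discounted_cost D h K cbar alpha Q)%E.
Proof.
move=> a0 c0 Vsub Vle.
rewrite expected_discounted_costE.
pose p t := ((alpha ^+ t)%:E * mean_stage_cost Q t)%E.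
have p0 t : (0 <= p t)%E.
  by rewrite mule_ge0 ?mean_stage_cost_ge0// lee_fin exprn_ge0.
have [->|/eqP Snoo] := pselect ((\sum_(0 <= t <oo) p t)%E = +oo%E); first exact: leey.
have Slty : (\sum_(0 <= t <oo) p t < +oo)%E by rewrite ltey.
have V_next n : (\int[Q]_w (V (state_at n.+1 w))%:E <=
    a%:E + c%:E * mean_stage_cost Q n)%E.
  have [mh _] := h_int.
  have mhn : measurable_fun setT
      ((fun w => (h (state_at n.+1 w))%:E) : trajectory iota -> \bar R).
    by apply/measurable_EFinP; apply: (measurableT_comp mh); exact: measurable_state_at.
  apply: (@le_trans _ _ (\int[Q]_w (a%:E + c%:E * (h (state_at n.+1 w))%:E))%E).
    apply: ge0_le_integral => //=.
    - by move=> w _; rewrite lee_fin.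
    - by apply: emeasurable_funD => //; exact: emeasurable_funM.
    - by move=> w _; rewrite -EFinM -EFinD lee_fin.
  rewrite ge0_integralD//=; last 2 first.
  - by move=> w _; rewrite -EFinM lee_fin mulr_ge0.
  - exact: emeasurable_funM.
  rewrite integral_cst// [X in (_ * X)%E](probability_setT Q) mule1 leeD2l//.
  rewrite ge0_integralZl_EFin//; last by move=> w _; rewrite lee_fin.
  rewrite lee_wpmul2l ?lee_fin// (transition_mean is_scale D_iid strategic)//.
  apply: ge0_le_integral => //=.
  - by move=> w _; rewrite lee_fin after_demand_ge0.
  - apply/measurable_EFinP.
    apply: (measurableT_comp (measurable_after_demand is_scale (D 0) mh h_ge0)).
    exact: (measurable_post_order is_scale).
  - by apply/measurable_EFinP; exact: measurable_stage_cost.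
  - move=> w _; rewrite lee_fin lerDr.
    exact: (order_cost_ge0 is_scale K_gt0 cbar_gt0 (amount_ge0 _)).
(* A bound for the remainder after n.+1 periods; the n-th term of the series is
   bounded by the tail that starts with it. *)
pose r n := ((a * alpha ^+ n)%:E + c%:E * \sum_(n <= k <oo) p k)%E.
have r_cvg : (r n @[n --> \oo] --> 0)%E.
  rewrite -[X in _ --> X](_ : ((a * 0)%:E + c%:E * 0 = 0)%E); last first.
    by rewrite mulr0 mule0 adde0.
  apply: cvgeD => //.
    apply: cvg_EFin; first by apply: nearW.
    apply: cvgM; first exact: cvg_cst.
    by apply: cvg_expr; rewrite ger0_norm.
  apply: cvgeZl => //; exact: nneseries_tail_cvg.
have S_ge n : ((V x)%:E <= \sum_(0 <= t <oo) p t + r n)%E.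
  apply: (le_trans (subsolution_partial_sums n.+1 Vsub)).
  apply: leeD.
    by apply: nneseries_lim_ge => k _ _; exact: p0.
  have an : (0 <= (alpha ^+ n.+1)%:E)%E by rewrite lee_fin exprn_ge0.
  apply: (le_trans (lee_wpmul2l an (V_next n))).
  rewrite ge0_muleDr// ?mule_ge0 ?mean_stage_cost_ge0 ?lee_fin//.
  apply: leeD.
    rewrite -EFinM lee_fin mulrC ler_wpM2l// exprS ler_piMl ?exprn_ge0//.
    exact: ltW.
  rewrite muleCA lee_wpmul2l ?lee_fin//.
  apply: (@le_trans _ _ (p n)).
    rewrite /p; apply: lee_wpmul2r; first exact: mean_stage_cost_ge0.
    by rewrite lee_fin exprS ler_piMl ?exprn_ge0// ltW.
  by apply: le_trans (nneseries_lim_ge n.+1 _) => //; rewrite big_nat1.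
have cvS : (\sum_(0 <= t <oo) p t + r n @[n --> \oo] --> \sum_(0 <= t <oo) p t)%E.
  rewrite -[X in _ --> X]adde0; apply: cvgeD; [|exact: cvg_cst|exact: r_cvg].
  exact: fin_num_adde_defl.
rewrite -(cvg_lim _ cvS)//; apply: lime_ge.
  by apply/cvg_ex; eexists; exact: cvS.
by apply: nearW.
Qed.

(** Iterating the opposite inequality accumulates the errors eps alpha^n, which form a
    geometric series; the remainder has the right sign. *)
Lemma cost_le_supersolution (eps : R) : 0 <= eps ->
  (forall t, \int[Q]_w (cost_to_go (D 0) h K cbar alpha V
      (state_at t w) (amount (action_at t w)))%:E <=
    \int[Q]_w (V (state_at t w))%:E + eps%:E)%E ->
  (expected_discounted_cost D h K cbar alpha Q <=
   (V x + eps * (1 - alpha)^-1)%:E)%E.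
Proof.
move=> eps0 super; have [mV _] := V_int.
rewrite expected_discounted_costE.
have intV0 t : (0 <= \int[Q]_w (V (state_at t w))%:E)%E.
  by apply: integral_ge0 => w _; rewrite lee_fin.
have an0 n : (0 <= (alpha ^+ n)%:E :> \bar R)%E by rewrite lee_fin exprn_ge0.
(* The accumulated errors are kept in closed form through the induction. *)
have geo n : eps * alpha ^+ n + eps * (1 - alpha ^+ n) * (1 - alpha)^-1 =
    eps * (1 - alpha ^+ n.+1) * (1 - alpha)^-1.
  have na : 1 - alpha != 0 by rewrite subr_eq0 gt_eqF.
  by rewrite exprS; field.
have partial n : (\sum_(0 <= t < n) (alpha ^+ t)%:E * mean_stage_cost Q t +
    (alpha ^+ n)%:E * \int[Q]_w (V (state_at n w))%:E <=
    (V x + eps * (1 - alpha ^+ n) * (1 - alpha)^-1)%:E)%E.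
  elim: n => [|n IH].
    by rewrite big_nil add0e expr0 mul1e (initial_mean is_scale strategic)//
      subrr mulr0 mul0r addr0.
  rewrite big_nat_recr//= -addeA exprSr EFinM -muleA -ge0_muleDr
    ?mean_stage_cost_ge0 ?mule_ge0 ?lee_fin// -mean_cost_to_go.
  have := lee_wpmul2l (an0 n) (super n); rewrite [X in (_ <= X)%E]ge0_muleDr ?lee_fin// => step.
  apply: (le_trans (leeD2l _ step)); rewrite addeA.
  apply: (le_trans (leeD2r _ IH)).
  by rewrite -EFinM -EFinD lee_fin -exprSr -geo; lra.
apply: lime_le.
  apply: is_cvg_nneseries => t _ _.
  by rewrite mule_ge0 ?mean_stage_cost_ge0.
apply: nearW => n; apply: le_trans (le_trans (partial n) _).
  by rewrite leeDl// mule_ge0.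
rewrite lee_fin lerD2l; apply: ler_wpM2r; first by rewrite invr_ge0 subr_ge0 ltW.
by rewrite ler_piMr// gerBl exprn_ge0.
Qed.

End bounds.
End verification.

(** * Independence of a demand from the past *)

Section independence.
Context (R : realType) (d : measure_display) (Omega : measurableType d).
Context (P : probability Omega R).

(** The joint law of [Y] and [Z] is the product of their laws since the two agree on
    rectangles; measure the sections of [S] over [B]. *)
Lemma independent_sections d1 d2 (E : measurableType d1) (F : measurableType d2)
    (Y : Omega -> E) (Z : Omega -> F) (S : set (E * F)) (B : set E) :
  measurable_fun setT Y -> measurable_fun setT Z ->
  (forall A C, measurable A -> measurable C ->
    P (Y @^-1` A `&` Z @^-1` C) = (P (Y @^-1` A) * P (Z @^-1` C))%E) ->
  measurable S -> measurable B ->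
  P [set u | B (Y u) /\ S (Y u, Z u)] =
  (\int[P]_(u in Y @^-1` B) P [set v | S (Y u, Z v)])%E.
Proof.
move=> mY mZ indep mS mB.
have mYZ : measurable_fun setT (fun u => (Y u, Z u)) by exact: measurable_fun_pair.
pose Yf : {mfun Omega >-> E} := HB.pack Y (isMeasurableFun.Build _ _ _ _ _ mY).
pose Zf : {mfun Omega >-> F} := HB.pack Z (isMeasurableFun.Build _ _ _ _ _ mZ).
pose YZf : {mfun Omega >-> (E * F)%type} :=
  HB.pack (fun u => (Y u, Z u)) (isMeasurableFun.Build _ _ _ _ _ mYZ).
have joint X : measurable X ->
    (distribution P Yf \x distribution P Zf)%E X = distribution P YZf X.
  apply: product_measure_unique => A C mA mC.
  by rewrite [RHS]/= /distribution /pushforward -indep.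
have mSB : measurable ((B `*` setT) `&` S).
  by apply: measurableI => //; exact: measurableX.
transitivity (distribution P YZf ((B `*` setT) `&` S)).
  rewrite /distribution /pushforward; congr (P _).
  by apply/seteqP; split=> u [] // [].
rewrite -joint// /product_measure1.
have mphi : measurable_fun setT (fun y => distribution P Zf (xsection S y)).
  exact: measurable_fun_xsection.
transitivity (\int[distribution P Yf]_(y in B) distribution P Zf (xsection S y))%E.
  rewrite [RHS]integral_mkcond; apply: eq_integral => y _ /=.
  rewrite patchE; case: ifPn => [/set_mem By|yB].
    rewrite /distribution /pushforward; congr (P _).
    apply/seteqP; split=> u /=; first by move=> /set_mem[_ Su]; exact: mem_set.
    by move=> /set_mem Su; apply: mem_set; split.
  rewrite (_ : xsection _ y = set0) ?measure0//.
  by apply/seteqP; split=> // z /= /set_mem[[By _] _]; move: yB; rewrite mem_set.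
rewrite ge0_integral_pushforward//; last exact: measurable_funTS.
apply: eq_integral => u _ /=; rewrite /distribution /pushforward; congr (P _).
  by apply/seteqP; split=> v /=; [exact: set_mem|exact: mem_set].
Qed.

Context (d' : measure_display) (F : measurableType d').
Context (D : nat -> {RV P >-> F}).
Hypothesis D_indep : mutually_independent D.

(** A generating pi-system of the events that depend on the first [t] demands only. *)
Definition past_cylinders (t : nat) : set (set Omega) :=
  [set A | exists2 B : nat -> set F, (forall i, measurable (B i)) &
    A = \bigcap_(i in [set i | (i < t)%N]) (D i @^-1` B i)].

Lemma past_cylindersT t : past_cylinders t setT.
Proof.
by exists (fun=> setT) => //; apply/seteqP; split=> // u _ i _.
Qed.

Lemma past_cylindersI t : setI_closed (past_cylinders t).
Proof.
move=> _ _ [B mB ->] [B' mB' ->]; exists (fun i => B i `&` B' i).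
  by move=> i; exact: measurableI.
by apply/seteqP; split=> [u [Bu B'u] i it|u BB]; [split; [exact: Bu|exact: B'u]|
  split=> i /BB []].
Qed.

Lemma past_cylinders_measurable t A : past_cylinders t A -> measurable A.
Proof.
move=> [B mB ->]; apply: bigcap_measurableType => i _.
by rewrite -[X in measurable X]setTI; exact: measurable_funP.
Qed.

Lemma past_cylinders_demand t i (B : set F) : (i < t)%N -> measurable B ->
  past_cylinders t (D i @^-1` B).
Proof.
move=> it mB; exists (fun j => if j == i then B else setT) => [j|].
  by case: ifP.
apply/seteqP; split=> [u Bu j _|u /(_ i it)]; last by rewrite eqxx.
by case: eqP => [->|_].
Qed.

Lemma past_cylinders_independent t A C : past_cylinders t A -> measurable C ->
  P (A `&` D t @^-1` C) = (P A * P (D t @^-1` C))%E.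
Proof.
move=> [B mB ->] mC.
pose B' j := if j == t then C else B j.
have mB' j : measurable (B' j) by rewrite /B'; case: ifP.
have setE n (G : nat -> set Omega) : \bigcap_(i in [set i | (i < n)%N]) G i =
    \bigcap_(i in [set` [fset i in iota 0 n]%fset]) G i.
  apply/seteqP; split=> u Gu i /=.
    by rewrite in_fset mem_iota add0n => /andP[_]; exact: Gu.
  by move=> it; apply: Gu; rewrite /= in_fset mem_iota.
have prodE n (G : nat -> \bar R) :
    (\prod_(i <- [fset i in iota 0 n]%fset) G i = \prod_(i < n) G i)%E.
  rewrite (perm_big (iota 0 n)) /=; last first.
    apply: uniq_perm; [exact: fset_uniq|exact: iota_uniq|].
    by move=> i; rewrite in_fset.
  by rewrite -(big_mkord xpredT) /index_iota subn0.
have B't i : (i < t)%N -> B' i = B i by rewrite /B'; case: eqP => // ->; rewrite ltnn.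
have lhs : \bigcap_(i in [set i | (i < t)%N]) (D i @^-1` B i) `&` D t @^-1` C =
    \bigcap_(i in [set i | (i < t.+1)%N]) (D i @^-1` B' i).
  apply/seteqP; split=> [u [Bu Cu] i /=|u Bu].
    rewrite ltnS leq_eqVlt => /predU1P[->|it]; first by rewrite /B' eqxx.
    by rewrite B't//; exact: Bu.
  split=> [i it|]; last by have := Bu t (ltnSn t); rewrite /B' eqxx.
  by have := Bu i (ltnW it); rewrite B't.
rewrite lhs !setE !D_indep// !prodE big_ord_recr /= {2}/B' eqxx; congr (_ * _)%E.
by apply: eq_bigr => i _; rewrite B't.
Qed.

(** As functions of [A], both sides are finite measures on the sigma-algebra generated by
    the past cylinders, and they agree on the cylinders by independence. *)
Lemma past_independent t A C : <<s past_cylinders t >> A -> measurable C ->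
  P (A `&` D t @^-1` C) = (P A * P (D t @^-1` C))%E.
Proof.
move=> sA mC.
pose Past := g_sigma_algebraType (past_cylinders t).
have mid : measurable_fun setT (id : Omega -> Past).
  move=> _ B sB; rewrite setTI preimage_id.
  have : <<s past_cylinders t >> `<=` (measurable : set (set Omega)).
    apply: smallest_sub; first exact: sigma_algebra_measurable.
    by move=> G; exact: past_cylinders_measurable.
  exact.
have mDC : measurable (D t @^-1` C).
  by rewrite -[X in measurable X]setTI; exact: measurable_funP.
have PC0 : 0 <= fine (P (D t @^-1` C)) by exact: fine_ge0.
(* The left-hand and the right-hand side as measures on the past. *)
pose m1 : {measure set Past -> \bar R} := pushforward (mrestr P mDC) (id : Omega -> Past).
pose m2 : {measure set Past -> \bar R} :=
  mscale (NngNum PC0) (pushforward P (id : Omega -> Past)).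
have PCE : (fine (P (D t @^-1` C)))%:E = P (D t @^-1` C).
  by rewrite fineK// fin_num_measure.
have agree B : past_cylinders t B -> m1 mid B = m2 mid B.
  move=> GB; rewrite /m1 /m2 /= /mscale /pushforward /mrestr !preimage_id /= PCE.
  by rewrite past_cylinders_independent// muleC.
have cover : \bigcup_(k in [set: nat]) ((fun=> setT) : nat -> set Past) k = setT.
  by rewrite -subTset => u _; exists 0%N.
have m1fin (k : nat) : (m1 mid (setT : set Past) < +oo)%E.
  rewrite /m1 /= /pushforward /mrestr preimage_setT setTI.
  by rewrite -ge0_fin_numE// fin_num_measure.
have := @measure_unique _ R Past (past_cylinders t) (fun=> setT) erefl
  (@past_cylindersI t) (fun=> past_cylindersT t) cover
  (m1 mid) (m2 mid) agree m1fin A sA.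
rewrite /m1 /m2 /= /mscale /pushforward /mrestr !preimage_id /= PCE => ->.
by rewrite muleC.
Qed.
End independence.

(** * The process driven by a stationary policy *)

Section stationary_policy.
Context (R : realType) (T : realDomainType) (iota : T -> R) (grid : nat -> T).
Hypothesis is_scale : inventory_scale iota grid.
Context (f : T -> T).
Hypothesis f_ge0 : forall y, 0 <= f y.
Hypothesis mf : measurable_fun setT (f : stock iota -> stock iota).

Definition order_of (y : stock iota) : order_quantity iota := exist _ (f y) (f_ge0 y).

Lemma measurable_order_of : measurable_fun setT order_of.
Proof. by apply: measurable_to_order; exact: measurable_scale_comp. Qed.

(** The stocks as a function of the sequence of demands; the level at time [t] depends
    on the first [t] demands only. *)
Fixpoint stock_path (x : T) (delta : nat -> T) (t : nat) : T :=
  if t is s.+1 then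
    stock_path x delta s + f (stock_path x delta s) - delta s
  else x.

Definition path_trajectory (x : T) (delta : nat -> T) : trajectory iota :=
  fun t => (stock_path x delta t, order_of (stock_path x delta t)).

(** The measurable space is arbitrary: the lemma is used both for the whole probability
    space and for the sigma-algebra of the past. *)
Lemma measurable_stock_path d (X : measurableType d) (delta : nat -> X -> stock iota)
    x t : (forall i, (i < t)%N -> measurable_fun setT (delta i)) ->
  measurable_fun setT ((fun u => stock_path x (delta ^~ u) t) : X -> stock iota).
Proof.
elim: t => [|t IH] mdelta /=; first exact: measurable_cst.
have mpath := IH (fun i it => mdelta i (ltnW it)).
apply: (measurable_stockB is_scale); last exact: mdelta.
apply: (measurable_stockD is_scale) => //.
exact: (measurableT_comp mf mpath).
Qed.

Lemma measurable_history_at d (X : measurableType d) (w : X -> trajectory iota) t :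
  (forall i, (i <= t)%N ->
     measurable_fun setT ((fun u => w u i) : X -> (stock iota * order_quantity iota)%type)) ->
  measurable_fun setT (fun u => (history_at t (w u), action_at t (w u))).
Proof.
move=> mw; apply: measurable_fun_pair; last exact: (measurableT_comp measurable_snd (mw t _)).
apply: measurable_fun_pair; last exact: (measurableT_comp measurable_fst (mw t _)).
apply/measurable_fun_tnthP => i.
rewrite (_ : _ \o _ = fun u => w u i); first by apply: mw; exact: ltnW.
by apply/funext => u /=; rewrite tnth_mktuple.
Qed.

Lemma measurable_path_at d (X : measurableType d) (delta : nat -> X -> stock iota) x t :
  (forall i, (i < t)%N -> measurable_fun setT (delta i)) ->
  measurable_fun setT ((fun u => path_trajectory x (delta ^~ u) t) :
    X -> (stock iota * order_quantity iota)%type).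
Proof.
move=> mdelta; apply: measurable_fun_pair; first exact: measurable_stock_path.
by apply: (measurableT_comp measurable_order_of); exact: measurable_stock_path.
Qed.

Lemma measurable_path_trajectory d (X : measurableType d)
    (delta : nat -> X -> stock iota) x :
  (forall i, measurable_fun setT (delta i)) ->
  measurable_fun setT ((fun u => path_trajectory x (delta ^~ u)) : X -> trajectory iota).
Proof.
move=> mdelta.
apply: (@measurability _ _ X (trajectory iota) setT _
  (\bigcup_t preimage_set_system setT
     (fun w : nat -> (stock iota * order_quantity iota)%type => w t) measurable)) => //.
move=> _ [_ [t _ [B mB <-]] <-]; rewrite setTI.
have := @measurable_path_at _ X delta x t (fun i _ => mdelta i) measurableT B mB.
by rewrite !setTI.
Qed.

Lemma measurable_history_order t :
  measurable_fun setT (fun y : history iota t => order_of y.2).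
Proof. by apply: (measurableT_comp measurable_order_of). Qed.

Definition stationary_policy : policy iota :=
  fun t => kdirac (@measurable_history_order t).

Context (d : measure_display) (Omega : measurableType d).
Context (P : probability Omega R) (D : nat -> {RV P >-> stock iota}).
Hypothesis D_indep : mutually_independent D.

Let traj (x : T) (u : Omega) : trajectory iota := path_trajectory x (fun t => D t u).

Lemma measurable_driven_trajectory x : measurable_fun setT (traj x).
Proof. by apply: measurable_path_trajectory => i; exact: measurable_funP. Qed.

HB.instance Definition _ x :=
  isMeasurableFun.Build _ _ _ _ (traj x) (measurable_driven_trajectory x).

(** For a deterministic stationary policy the process is an explicit function of the
    demands, so that its law is an image measure. *)
Definition driven_law (x : T) : probability (trajectory iota) R :=
  distribution P (traj x).

(** The conditional law of an order is a Dirac mass, and the next stock is a function of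
    the present and of a demand that is independent of the past. *)
Lemma driven_law_strategic x : strategic_measure D stationary_policy x (driven_law x).
Proof.
have mtraj := measurable_driven_trajectory x.
split.
- rewrite /driven_law /= /distribution /pushforward.
  by rewrite (_ : _ @^-1` _ = setT) ?probability_setT//; apply/seteqP.
- move=> t B C mB mC.
  have mhist : measurable_fun setT (fun w : trajectory iota => history_at t w).
    have := @measurable_history_at _ (trajectory iota) id t (fun i _ => @measurable_at R T iota i).
    by move/(measurableT_comp measurable_fst).
  have mE : measurable [set w : trajectory iota | B (history_at t w)].
    by have := mhist measurableT _ mB; rewrite setTI.
  have mord : measurable_fun setT (fun w : trajectory iota => order_of (state_at t w)).
    exact: (measurableT_comp measurable_order_of (measurable_state_at t)).
  have mF : measurable [set w : trajectory iota | C (order_of (state_at t w))].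
    by have := mord measurableT _ mC; rewrite setTI.
  transitivity (\int[driven_law x]_(w in [set w | B (history_at t w)])
      (\1_[set w : trajectory iota | C (order_of (state_at t w))] w)%:E)%E; last first.
    apply: eq_integral => w _.
    rewrite /stationary_policy /kdirac /= diracE indicE.
    by congr ((nat_of_bool _)%:R%:E); apply/idP/idP => /set_mem Cw; exact/mem_set.
  rewrite integral_indic//.
  by congr (P _); apply/seteqP; split=> u [].
- move=> t B C mB mC.
  have mpast : measurable_fun setT
      (fun u => (history_at t (traj x u), action_at t (traj x u))).
    apply: measurable_history_at => i _; apply: measurable_path_at => j _.
    exact: measurable_funP.
  pose S := [set yz : (history iota t * order_quantity iota) * stock iota |
    C ((yz.1.1.2 : T) + amount yz.1.2 - (yz.2 : T))].
  have mS : measurable S.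
    have mnext : measurable_fun setT
        ((fun yz : (history iota t * order_quantity iota) * stock iota =>
          (yz.1.1.2 : T) + amount yz.1.2 - (yz.2 : T)) : _ -> stock iota).
      apply: (measurable_stockB is_scale); last exact: measurable_snd.
      apply: (measurable_stockD is_scale).
        by apply: (measurableT_comp measurable_snd);
          exact: (measurableT_comp measurable_fst measurable_fst).
      apply: (@measurableT_comp _ _ _ _ _ _ (@amount R T iota : _ -> stock iota)).
        exact: measurable_amount.
      exact: (measurableT_comp measurable_snd measurable_fst).
    by have := mnext measurableT _ mC; rewrite setTI.
  have indep A E : measurable A -> measurable E ->
      P ((fun u => (history_at t (traj x u), action_at t (traj x u))) @^-1` A `&`
         D t @^-1` E) =
      (P ((fun u => (history_at t (traj x u), action_at t (traj x u))) @^-1` A) *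
       P (D t @^-1` E))%E.
    move=> mA mE; apply: (past_independent D_indep) => //.
    (* The history up to time t is measurable for the past: construct it again on
       the probability space with the sigma-algebra of the past. *)
    have mdelta i : (i < t)%N -> measurable_fun setT
        (D i : g_sigma_algebraType (past_cylinders D t) -> stock iota).
      move=> it _ G mG; rewrite setTI; apply: sub_sigma_algebra.
      exact: past_cylinders_demand.
    have := @measurable_history_at _ (g_sigma_algebraType (past_cylinders D t))
      (traj x) t (fun i it => @measurable_path_at _ _
         (fun i => D i : g_sigma_algebraType (past_cylinders D t) -> stock iota) x i
         (fun j ji => mdelta j (leq_trans ji it))) measurableT A mA.
    by rewrite setTI.
  have mDt : measurable_fun setT (D t) by exact: measurable_funP.
  have := independent_sections mpast mDt indep mS mB.
  rewrite /S /= => E.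
  transitivity (P [set u | B (history_at t (traj x u), action_at t (traj x u)) /\
    C (state_at t (traj x u) + amount (action_at t (traj x u)) - D t u)]).
    by congr (P _).
  rewrite [LHS]E.
  have mpair : measurable_fun setT
      (fun w : trajectory iota => (history_at t w, action_at t w)).
    exact: (@measurable_history_at _ (trajectory iota) id t
      (fun i _ => @measurable_at R T iota i)).
  have mEB : measurable [set w : trajectory iota | B (history_at t w, action_at t w)].
    by have := mpair measurableT _ mB; rewrite setTI.
  have mnext : measurable_fun setT (fun w : trajectory iota =>
      distribution P (D t) (xsection S (history_at t w, action_at t w))).
    apply: (@measurableT_comp _ _ _ _ _ _ (fun y => distribution P (D t) (xsection S y)))
      mpair.
    exact: measurable_fun_xsection.
  have nextE w : distribution P (D t) (xsection S (history_at t w, action_at t w)) =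
      P [set u | C (next_state D t (state_at t w) (action_at t w) u)].
    rewrite /distribution /pushforward; congr (P _).
    by apply/seteqP; split=> v /=; [move=> /set_mem|move=> Cv; apply: mem_set].
  transitivity (\int[driven_law x]_(w in [set w | B (history_at t w, action_at t w)])
      distribution P (D t) (xsection S (history_at t w, action_at t w)))%E; last first.
    by apply: eq_integral => w _; exact: nextE.
  rewrite /driven_law ge0_integral_pushforward//; last exact: measurable_funTS.
  apply: eq_integral => u _ /=; rewrite /distribution /pushforward; congr (P _).
  by apply/seteqP; split=> v /=; [move=> Cv; apply: mem_set|move=> /set_mem].
Qed.

(** Almost every trajectory follows the policy, so that it suffices to compare the two
    functions on these. *)
Lemma driven_law_le x (F G : trajectory iota -> \bar R) :
  measurable_fun setT F -> measurable_fun setT G ->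
  (forall w, 0 <= F w)%E -> (forall w, 0 <= G w)%E ->
  (forall w, (forall t, action_at t w = order_of (state_at t w)) -> F w <= G w)%E ->
  (\int[driven_law x]_w F w <= \int[driven_law x]_w G w)%E.
Proof.
move=> mF mG F0 G0 FG; have mtraj := measurable_driven_trajectory x.
rewrite !ge0_integral_pushforward// preimage_setT.
apply: ge0_le_integral => //; [by move=> u _; exact: F0|exact: measurableT_comp|
  exact: measurableT_comp|].
by move=> u _; exact: FG.
Qed.

End stationary_policy.

(** * Measurable selection *)

Section first_index.
Context (d : measure_display) (X : measurableType d).
Context (good : X -> nat -> bool).
Hypothesis good_ex : forall x, exists k, good x k.
Hypothesis mgood : forall k, measurable [set x | good x k].

(** Taking the least good index makes the selection measurable. *)
Definition first_index (x : X) : nat := ex_minn (good_ex x).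

Lemma first_indexP x : good x (first_index x).
Proof. by rewrite /first_index; case: ex_minnP. Qed.

Lemma measurable_first_index (Y : set nat) : measurable [set x | Y (first_index x)].
Proof.
rewrite (_ : mkset _ = \bigcup_(k in Y) ([set x | good x k] `&`
    \bigcap_(j in [set j | (j < k)%N]) ~` [set x | good x j])).
  apply: bigcup_measurable => k _; apply: measurableI => //.
  by apply: bigcap_measurableType => j _; exact: measurableC.
apply/seteqP; split=> [x Yx|x [k Yk [gk ngk]]] /=.
  exists (first_index x) => //; split; first exact: first_indexP.
  move=> j /=; rewrite /first_index; case: ex_minnP => k _ kmin jk /kmin.
  by rewrite leqNgt jk.
rewrite /first_index; case: ex_minnP => k' gk' /(_ k gk).
rewrite leq_eqVlt => /predU1P[->//|k'k].
by have := ngk k' k'k; case.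
Qed.

End first_index.

(** * Identification of the optimal value *)

Section optimal_value.
Context (R : realType) (T : realDomainType) (iota : T -> R) (grid : nat -> T).
Hypothesis is_scale : inventory_scale iota grid.
Context (d : measure_display) (Omega : measurableType d).
Context (P : probability Omega R) (D : nat -> {RV P >-> stock iota}).
Context (h : T -> R) (K cbar alpha : R).
Hypotheses (K_gt0 : 0 < K) (cbar_gt0 : 0 < cbar).
Hypotheses (h_ge0 : forall x, 0 <= h x) (h0 : h 0 = 0).
Hypotheses (h_convex : convex_on_carrier iota h) (h_coercive : coercive iota h).
Hypotheses (D_indep : mutually_independent D) (D_iid : identically_distributed D).
Hypothesis D_ge0 : forall t u, 0 <= demand D t u.
Hypothesis D_mean : ('E_P[fun u => iota (demand D 0 u)] < +oo)%E.
Hypothesis h_mean : forall x, (expected_holding_cost D h x < +oo)%E.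
Hypotheses (alpha_ge0 : 0 <= alpha) (alpha_lt1 : alpha < 1).

Let X_ge0 u : 0 <= (D 0 u : T). Proof. exact: D_ge0. Qed.

Let integrable_of_mean (phi : Omega -> R) :
  measurable_fun setT phi -> (forall u, 0 <= phi u) ->
  (\int[P]_u (phi u)%:E < +oo)%E -> P.-integrable setT (fun u => (phi u)%:E).
Proof.
move=> mphi phi0 fin; apply/integrableP; split; first exact/measurable_EFinP.
by under eq_integral do rewrite gee0_abs ?lee_fin//.
Qed.

Lemma holding_integrable : demand_integrable (D 0) h.
Proof.
have mh := measurable_holding is_scale h_ge0 h0 h_convex.
split => // x; apply: integrable_of_mean => //.
  exact: (measurable_after_comp is_scale).
by have := h_mean x; rewrite /expected_holding_cost unlock.
Qed.

Lemma shortage_integrable : demand_integrable (D 0) (shortage iota).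
Proof.
have mD : measurable_fun setT (fun u => iota (D 0 u)).
  by apply: measurable_scale_comp; exact: measurable_funP.
have Dint : P.-integrable setT (fun u => (iota (D 0 u))%:E).
  apply: integrable_of_mean => //.
    by move=> u; rewrite (scale_ge0 is_scale).
  by move: D_mean; rewrite unlock.
split; first exact: measurable_shortage.
move=> x.
have cint : P.-integrable setT (EFin \o cst (shortage iota x)).
  exact: finite_measure_integrable_cst.
have := integrableD measurableT cint Dint; apply: le_integrable => //.
  apply/measurable_EFinP; apply: (measurable_after_comp is_scale).
  exact: measurable_shortage.
move=> u _ /=; rewrite lee_fin ger0_norm ?shortage_ge0//.
apply: le_trans (ler_norm _).
exact: (shortage_after is_scale).
Qed.

Let V := value grid (D 0) h K cbar alpha.

Let V_below := value_below is_scale X_ge0 K_gt0 cbar_gt0 alpha_ge0 alpha_lt1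
  h_ge0 h0 h_convex holding_integrable shortage_integrable.

Let V_int : demand_integrable (D 0) V.
Proof.
exact: (below_base_stock_integrable is_scale X_ge0 K_gt0 cbar_gt0 alpha_ge0
  alpha_lt1 h_ge0 h0 h_convex shortage_integrable V_below).
Qed.

Let V_ge0 x : 0 <= V x.
Proof. by have [_ /(_ x) /andP[]] := V_below. Qed.

(** The bound [base_stock_bound] contains the shortage, which [h] dominates by its linear
    growth. *)
Lemma value_growth : exists a c, [/\ 0 <= a, 0 <= c & forall y, V y <= a + c * h y].
Proof.
have [m m0 hm] := holding_grows_linearly is_scale h_ge0 h0 h_convex h_coercive.
set C := (1 - alpha)^-1.
have C0 : 0 < C by rewrite invr_gt0 subr_gt0.
pose S := K + after_demand (D 0) h 0 + alpha * (cbar * after_demand (D 0) (shortage iota) 0).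
have S0 : 0 <= S.
  rewrite !addr_ge0 ?after_demand_ge0 ?(ltW K_gt0)// !mulr_ge0 ?(ltW cbar_gt0)//.
  by apply: after_demand_ge0 => y; exact: shortage_ge0.
exists (C * S + cbar * m), (cbar * m + C); split.
- by rewrite addr_ge0// mulr_ge0// ltW.
- by rewrite addr_ge0 ?(ltW C0)// mulr_ge0// ltW.
move=> y; have [_ /(_ y) /andP[_ Vy]] := V_below.
apply: (le_trans Vy); rewrite /base_stock_bound -/C -/S.
have sy : cbar * shortage iota y <= cbar * (m * (1 + h y)).
  rewrite ler_pM2l// /shortage ge_max hm/=.
  by rewrite mulr_ge0 ?(ltW m0)// addr_ge0.
have hy : C * h (Num.max y 0) <= C * h y.
  by rewrite ler_pM2l//; case: (leP y 0); rewrite // h0.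
by move: sy hy; lra.
Qed.

(** The value is a subsolution, and every law of the process, under any policy, costs at
    least as much as a subsolution. *)
Lemma value_le_optimal x : ((V x)%:E <= optimal_value D h K cbar alpha x)%E.
Proof.
have [a [c [a0 c0 Vle]]] := value_growth.
apply: le_ereal_inf_tmp => _ [pi _ <-]; apply: le_ereal_inf_tmp => _ [Q strat <-].
apply: (subsolution_le_cost is_scale D_iid K_gt0 cbar_gt0 alpha_ge0 alpha_lt1
  h_ge0 holding_integrable V_ge0 V_int strat a0 c0) => // y b b0.
exact: (value_le_cost_to_go is_scale X_ge0 K_gt0 cbar_gt0 alpha_ge0 alpha_lt1
  h_ge0 h0 h_convex holding_integrable shortage_integrable y b0).
Qed.

(** A stationary policy that chooses the first nearly optimal grid point is measurable, and
    its cost exceeds the value by at most the sum of the discounted errors. *)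
Lemma optimal_le_value x : (optimal_value D h K cbar alpha x <= (V x)%:E)%E.
Proof.
have a1 : 0 < 1 - alpha by rewrite subr_gt0.
apply/lee_addgt0Pr => e e0.
pose eps := e * (1 - alpha).
have eps0 : 0 < eps by rewrite mulr_gt0.
pose good (y : stock iota) k :=
  cost_to_go (D 0) h K cbar alpha V y (grid k) < V y + eps.
have good_ex y : exists k, good y k.
  exact: (value_near_optimal is_scale X_ge0 K_gt0 cbar_gt0 alpha_ge0 alpha_lt1
    h_ge0 h0 h_convex holding_integrable shortage_integrable y eps0).
have mgood k : measurable [set y | good y k].
  have [mV _] := V_below.
  have := @measurable_fun_ltr _ (stock iota) R setT
    (cost_to_go (D 0) h K cbar alpha V ^~ (grid k)) (fun y => V y + eps).
  move=> /(_ _ _ measurableT [set true]).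
  rewrite setTI; apply => //.
  - exact: (measurable_cost_to_go is_scale h_ge0 holding_integrable _ V_below).
  - exact: measurable_funD.
pose f (y : T) : T := grid (first_index good_ex y).
have f_ge0 y : 0 <= f y by exact: grid_ge0 is_scale _.
have mf : measurable_fun setT (f : stock iota -> stock iota).
  move=> _ B mB; rewrite setTI.
  exact: (measurable_first_index good_ex mgood (grid @^-1` B)).
have strat := driven_law_strategic is_scale f_ge0 mf D_indep x.
apply: (@le_trans _ _ (policy_value D h K cbar alpha (stationary_policy f_ge0 mf) x)).
  by apply: ereal_inf_lbound; exists (stationary_policy f_ge0 mf).
apply: (@le_trans _ _ (expected_discounted_cost D h K cbar alpha
    (driven_law is_scale f_ge0 mf D x))).
  by apply: ereal_inf_lbound; exists (driven_law is_scale f_ge0 mf D x).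
have -> : ((V x)%:E + e%:E = (V x + eps * (1 - alpha)^-1)%:E)%E.
  by rewrite /eps mulfK ?gt_eqF.
apply: (cost_le_supersolution is_scale D_iid K_gt0 cbar_gt0 alpha_ge0 alpha_lt1
  h_ge0 holding_integrable V_ge0 V_int strat (ltW eps0)) => t.
have [mV _] := V_below.
have mVt : measurable_fun setT
    ((fun w => (V (state_at t w))%:E) : trajectory iota -> \bar R).
  by apply/measurable_EFinP; apply: (measurableT_comp mV); exact: measurable_state_at.
have -> : eps%:E = (\int[driven_law is_scale f_ge0 mf D x]_w (cst eps%:E w))%E.
  by rewrite integral_cst// [X in (_ * X)%E]probability_setT mule1.
rewrite -ge0_integralD//; [|by move=> w _; rewrite lee_fin|by move=> w _; rewrite lee_fin ltW].
apply: driven_law_le.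
- exact: (measurable_cost_to_go_at is_scale _ _ _ h_ge0 holding_integrable V_ge0 V_int).
- by apply: emeasurable_funD.
- move=> w; rewrite lee_fin.
  by apply: (cost_to_go_ge0 is_scale _ K_gt0 cbar_gt0 alpha_ge0 h_ge0) => //;
    exact: amount_ge0.
- by move=> w; rewrite adde_ge0// lee_fin// ltW.
- move=> w act; rewrite act -EFinD lee_fin ltW//.
  exact: (first_indexP good_ex (state_at t w)).
Qed.

Lemma optimal_valueE x : optimal_value D h K cbar alpha x = (V x)%:E.
Proof. by apply/eqP; rewrite eq_le optimal_le_value value_le_optimal. Qed.

Lemma G_alphaE x : G_alpha D h K cbar alpha x =
  (cbar * iota x + post_order_cost (D 0) h alpha V x)%:E.
Proof.
rewrite /G_alpha (expected_holding_costE holding_integrable).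
under eq_integral do rewrite optimal_valueE.
by rewrite after_demand_fin// /post_order_cost addrA !EFinD EFinM.
Qed.

Lemma continuity_of_value_functions :
  real_valued_continuous iota (optimal_value D h K cbar alpha) /\
  real_valued_continuous iota (G_alpha D h K cbar alpha).
Proof.
split; split.
- by move=> x; rewrite optimal_valueE.
- rewrite (_ : optimal_value _ _ _ _ _ = EFin \o V); last first.
    by apply/funext => x; exact: optimal_valueE.
  apply: (controlled_continuous is_scale).
  exact: (value_controlled is_scale X_ge0 K_gt0 cbar_gt0 alpha_ge0 alpha_lt1
    h_ge0 h0 h_convex holding_integrable shortage_integrable).
- by move=> x; rewrite G_alphaE.
- rewrite (_ : G_alpha _ _ _ _ _ =
    EFin \o (fun x => cbar * iota x + post_order_cost (D 0) h alpha V x)); last first.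
    by apply/funext => x; exact: G_alphaE.
  apply: (controlled_continuous is_scale); apply: controlledD.
    exact: (linear_controlled is_scale).
  exact: (post_order_cost_controlled is_scale X_ge0 K_gt0 cbar_gt0 alpha_ge0
    alpha_lt1 h_ge0 h0 h_convex holding_integrable shortage_integrable).
Qed.

End optimal_value.

(** * The real and the integer setting *)

Definition rational_grid (R : realType) (k : nat) : R :=
  if (choice.unpickle k : option rat) is Some q then Num.max 0 (ratr q) else 0.

Lemma real_scale (R : realType) : inventory_scale (id : R -> R) (@rational_grid R).
Proof.
split => //.
  by move=> k; rewrite /rational_grid; case: choice.unpickle => // q; rewrite le_max lexx.
move=> a eta a0 eta0.
move: a0; rewrite le_eqVlt => /predU1P[<-|a0].
  exists (choice.pickle (0 : rat)); rewrite /rational_grid choice.pickleK rmorph0 maxxx.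
  by split => //; lra.
have [q] : exists q : rat, ratr q \in `]a, (a + eta)[ by apply: rat_in_itvoo; lra.
rewrite in_itv/= => /andP[aq qa].
exists (choice.pickle q); rewrite /rational_grid choice.pickleK max_r; last by lra.
by split; lra.
Qed.

Lemma integer_scale (R : realType) :
  inventory_scale (fun z : int => z%:~R : R) (fun k => k%:Z).
Proof.
split => //.
- by move=> x y; rewrite intrD.
- by move=> x y; rewrite ler_int.
move=> a eta a0 eta0; exists `|a|%N.
by rewrite gez0_abs//; split => //; lra.
Qed.

Theorem theorem5p3 (R : realType) (s : setting)
    (d : measure_display) (Omega : measurableType d) (P : probability Omega R)
    (D : nat -> {RV P >-> stock (@to_real R s)})
    (h : carrier R s -> R) (K cbar : R) :
  0 < K ->
  0 < cbar ->
  (forall x, 0 <= h x) ->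
  h 0 = 0 ->
  convex_on_carrier (@to_real R s) h ->
  coercive (@to_real R s) h ->
  mutually_independent D ->
  identically_distributed D ->
  (forall t u, 0 <= demand D t u) ->
  ('E_P[fun u => to_real (demand D 0 u)] < +oo)%E ->
  (0 < P [set u | (0 < demand D 0 u)%R])%E ->
  (forall x, expected_holding_cost D h x < +oo)%E ->
  forall alpha : R, 0 <= alpha < 1 ->
    real_valued_continuous (@to_real R s) (optimal_value D h K cbar alpha) /\
    real_valued_continuous (@to_real R s) (G_alpha D h K cbar alpha).
Proof.
move=> K0 c0 hge0 h0 hconv hco indep iid D0 Dmean _ hmean alpha /andP[a0 a1].
case: s D h hge0 h0 hconv hco indep iid D0 Dmean hmean => D h hge0 h0 hconv hco *.
  by apply: (continuity_of_value_functions (real_scale R)).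
by apply: (continuity_of_value_functions (integer_scale R)).
Qed.
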